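(* Let $b\in\mathbb{R}$ and $t\in\mathbb{R}\setminus\{0\}$, and let $M$ be a compact nilmanifold with underlying Lie algebra $\mathfrak{h}_2$ if $|b|<1$ ($M=M_2$), $\mathfrak{h}_4$ if $b=\pm1$ ($M=M_4$), $\mathfrak{h}_5$ if $b^2>1$ ($M=M_5$), endowed with the invariant balanced Hermitian structure $(J,g)$ depending on $(b,t)$ described in the context, with torsion $T$, Levi-Civita connection $\nabla^g$ and Bismut-Strominger connection $\nabla^+$. Let $A$ be the abelian $SU(3)$-instanton described in the context. Then $$dT=\frac{16\pi^2t^2(b^2+3)}{t^4(b^4+4b^2+11)-1}\,\big(p_1(\nabla^g)-p_1(A)\big),$$ $$dT=\frac{16\pi^2t^2(b^2+3)}{4t^4(b^4+5b^2+10)-1}\,\big(p_1(\nabla^+)-p_1(A)\big),$$ whenever the respective denominators are nonzero. For every $b\in\mathbb{R}$ one can choose $t\neq0$ such that $t^4(b^4+5b^2+10)>1/4$ and $t^4(b^4+4b^2+11)>1$, and for such $t$, $(M,J,g,A)$ is a solution to the heterotic supersymmetry equations with non-zero flux $H=T$ and constant dilaton which satisfies the three-form Bianchi identity both for the Levi-Civita connection and for the $(+)$-connection. In particular, such solutions are obtained on the compact nilmanifolds $M_2$, $M_4$, $M_5$.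
   Context: Notation: $e^{ij}=e^i\wedge e^j$, etc. The Lie algebras, given by $(de^1,\dots,de^6)$ with $ij$ short for $e^{ij}$: $\mathfrak{h}_2=(0,0,0,0,12,34)$, $\mathfrak{h}_4=(0,0,0,0,12,14+23)$, $\mathfrak{h}_5=(0,0,0,0,13+42,14+23)$. $M_2,M_4,M_5$ denote any compact nilmanifolds $\Gamma\backslash G$ ($G$ simply connected nilpotent, $\Gamma$ a lattice) with Lie algebra isomorphic to $\mathfrak{h}_2,\mathfrak{h}_4,\mathfrak{h}_5$, respectively. The structure: the Lie algebra (in the stated range of $b$) has a basis of complex $(1,0)$-forms with $d\omega^1=d\omega^2=0$, $d\omega^3=\omega^{12}+\omega^{1\bar1}+b\,\omega^{1\bar2}-\omega^{2\bar2}$. Put $e^1+ie^2=\omega^1$, $e^3+ie^4=\omega^2$, $e^5+ie^6=t\,\omega^3$. Then $de^1=de^2=de^3=de^4=0$, $de^5=t(b+1)e^{13}+t(b-1)e^{24}$, $de^6=-2t\,e^{12}-t(b-1)e^{14}+t(b+1)e^{23}+2t\,e^{34}$. The metric is $g=\sum_ie^i\otimes e^i$, and with $(Je)(X)=-e(JX)$ the complex structure is $Je^1=-e^2$, $Je^3=-e^4$, $Je^5=-e^6$ (on the dual frame: $JE_2=E_1$, $JE_4=E_3$, $JE_6=E_5$). The Kaehler form $F(X,Y)=g(X,JY)$ is $F=e^{12}+e^{34}+e^{56}$. Connections: $T(X,Y,Z)=-dF(JX,JY,JZ)$; $g(\nabla^+_XY,Z)=g(\nabla^g_XY,Z)+\frac12T(X,Y,Z)$.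 Balanced means $d*F=0$ (Lee form zero). Abelian instanton $A$: write $\omega^1=dz_1$, $\omega^2=dz_2$ on the Lie group. $A$ is an abelian connection ($U(1)=SO(2)$) on $M$ whose curvature is a real $2$-form of the shape $$\mathcal F=if\,dz_1\wedge d\bar z_1-if\,dz_2\wedge d\bar z_2+e^{i\gamma}\sqrt{\tfrac14-f^2}\,dz_1\wedge d\bar z_2-e^{-i\gamma}\sqrt{\tfrac14-f^2}\,dz_2\wedge d\bar z_1,$$ with real $f,\gamma$ (depending on $z_1,z_2$, $|f|\le\frac12$, $\mathcal F$ descending to $M$) satisfying $i\partial_{z_2}f+\partial_{z_1}(e^{-i\gamma}\sqrt{\frac14-f^2})=0$ and $i\partial_{z_1}f+\partial_{z_2}(e^{i\gamma}\sqrt{\frac14-f^2})=0$; $p_1(A)=\frac1{8\pi^2}\mathcal F\wedge\mathcal F$. Pontrjagin forms: for a metric connection with curvature $2$-forms $\Omega^i_j(X,Y)=g(R(X,Y)E_j,E_i)$ in an orthonormal frame, $p_1=\frac1{8\pi^2}\sum_{i<j}\Omega^i_j\wedge\Omega^i_j$. $SU(3)$-instanton: a connection whose curvature $\Omega$ satisfies $\Omega(JX,JY)=\Omega(X,Y)$ and $\sum_{k=1}^6\Omega(E_k,JE_k)=0$. Heterotic supersymmetry equations with constant dilaton for $(M,J,g,A)$: (i) $Hol(\nabla^+)\subset\mathfrak{su}(3)$, i.e. $\sum_i g(R^+(X,Y)JE_i,E_i)=0$; (ii) $(J,g)$ is balanced; (iii) $A$ is an $SU(3)$-instanton. The three-form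 Bianchi identity for a connection $\nabla$ on $TM$: $dT=\frac{\alpha'}{4}8\pi^2\big(p_1(\nabla)-p_1(A)\big)$ for some constant $\alpha'>0$. *)

(* Defs.v *)
From HB Require Import structures.
From mathcomp Require Import all_boot all_order all_algebra fingroup perm.
From mathcomp Require Import complex ring lra.
From mathcomp Require Import all_classical all_reals all_analysis.

Set Implicit Arguments.
Unset Strict Implicit.
Unset Printing Implicit Defensive.

Import Order.TTheory GRing.Theory Num.Theory.
Import numFieldNormedType.Exports.

Local Open Scope classical_set_scope.
Local Open Scope ring_scope.
Local Open Scope complex_scope.

Definition vec (R : realType) := 'rV[R]_6.

(* A nilpotent Lie algebra with underlying space R^6 and nilpotency step at
   most 2, which covers h_2, h_4 and h_5; the Jacobi identity is a consequence
   of [nil_step2]. *)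
Record nil_algebra (R : realType) := NilAlgebra {
  bra : vec R -> vec R -> vec R;
  bra_linear_l : forall a X Y Z, bra (a *: X + Y) Z = a *: bra X Z + bra Y Z;
  bra_linear_r : forall a X Y Z, bra Z (a *: X + Y) = a *: bra Z X + bra Z Y;
  bra_alt : forall X, bra X X = 0;
  nil_step2 : forall X Y Z, bra X (bra Y Z) = 0 }.

(* The simply connected Lie group of [L] in exponential coordinates: the
   manifold R^6 with the (here truncated) Baker-Campbell-Hausdorff product.
   The neutral element is 0 and the inverse of x is - x. *)
Definition gmul (R : realType) (L : nil_algebra R) (x y : vec R) : vec R :=
  x + y + 2^-1 *: bra L x y.

Record nilmanifold (R : realType) := Nilmanifold {
  nil_alg :> nil_algebra R;
  lattice : set (vec R);
  lattice1 : lattice 0;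
  latticeM : forall x y, lattice x -> lattice y -> lattice (gmul nil_alg x y);
  latticeV : forall x, lattice x -> lattice (- x);
  lattice_discrete : exists2 r : R, 0 < r &
    forall x, lattice x -> `|x| < r -> x = 0;
  lattice_cocompact : exists2 K : set (vec R), compact K &
    forall x, exists g k, [/\ lattice g, K k & x = gmul nil_alg g k] }.

(* Derivative of [f] at [x] along the left-invariant vector field of value [X]
   at the neutral element: d/ds x * (s X) at s = 0 is X + [x, X] / 2. *)
Definition lderive (R : realType) (W : normedModType R) (L : nil_algebra R)
    (X : vec R) (f : vec R -> W) (x : vec R) : W :=
  'D_(X + 2^-1 *: bra L x X) f x.

(* Differential p-forms on the group, with tangent spaces identified with the
   Lie algebra by left translations: [al x v] is the value at the point [x] on
   the left-invariant vector fields [v 0], ..., [v (p - 1)].  Forms on the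
   quotient by a lattice are the forms with [al (g * x) = al x] for g in the
   lattice; they are handled through their pull-backs to the group. *)
Definition form (R : realType) (K : Type) (p : nat) :=
  vec R -> ('I_p -> vec R) -> K.

Definition vec2 (R : realType) (X Y : vec R) : 'I_2 -> vec R :=
  fun i => if i == ord0 then X else Y.

Definition wedge (R : realType) (K : numFieldType) (p q : nat)
    (al : form R K p) (be : form R K q) : form R K (p + q) :=
  fun x v => (p`! * q`!)%:R^-1 *
    \sum_(s : 'S_(p + q)) (-1) ^+ (s : bool) *
      al x (fun i => v (s (lshift q i))) * be x (fun j => v (s (rshift p j))).

(* Cartan's formula on left-invariant fields.  In the second sum the bracket
   [v i, v j] is put in the slot of v i instead of in front, so that the usual
   sign (-1)^(i + j) becomes (-1)^j. *)
Definition ext_d (R : realType) (L : nil_algebra R) (p : nat)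
    (al : form R R p) : form R R p.+1 :=
  fun x v =>
    \sum_(i < p.+1) (-1) ^+ i *
      lderive L (v i) (fun y => al y (fun k => v (lift i k))) x +
    \sum_(i < p.+1) \sum_(j < p.+1 | (i < j)%N) (-1) ^+ j *
      al x (fun k => if lift j k == i then bra L (v i) (v j) else v (lift j k)).

Definition ext_dC (R : realType) (L : nil_algebra R) (p : nat)
    (al : form R R[i] p) : form R R[i] p.+1 :=
  fun x v => ext_d L (fun y w => complex.Re (al y w)) x v
          +i* ext_d L (fun y w => complex.Im (al y w)) x v.

Definition form_conj (R : realType) (p : nat) (al : form R R[i] p) :
  form R R[i] p := fun x v => conjc (al x v).

(* A coframe (e^1, ..., e^6) of left-invariant 1-forms is given by an invertible
   matrix P, whose k-th column is e^k; the dual frame (E_1, ..., E_6) consists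
   of the rows of the inverse of P.  Indices k run from 1 to 6. *)
Definition ix (k : nat) : 'I_6 := inord k.-1.

Definition cof (R : realType) (P : 'M[R]_6) (k : nat) (X : vec R) : R :=
  (X *m P) ord0 (ix k).

Definition frame (R : realType) (P : 'M[R]_6) (i : 'I_6) : vec R :=
  row i (invmx P).

Definition e1f (R : realType) (P : 'M[R]_6) (k : nat) : form R R 1 :=
  fun _ v => cof P k (v ord0).

Definition e2f (R : realType) (P : 'M[R]_6) (i j : nat) : form R R 2 :=
  wedge (e1f P i) (e1f P j).

Definition closed_cof (R : realType) (L : nil_algebra R) (P : 'M[R]_6) :=
  forall k, (0 < k < 5)%N -> forall x v, ext_d L (e1f P k) x v = 0.

Definition is_h2 (R : realType) (L : nil_algebra R) : Prop :=
  exists P : 'M[R]_6, [/\ P \in unitmx, closed_cof L P,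
    forall x v, ext_d L (e1f P 5) x v = e2f P 1 2 x v &
    forall x v, ext_d L (e1f P 6) x v = e2f P 3 4 x v].

Definition is_h4 (R : realType) (L : nil_algebra R) : Prop :=
  exists P : 'M[R]_6, [/\ P \in unitmx, closed_cof L P,
    forall x v, ext_d L (e1f P 5) x v = e2f P 1 2 x v &
    forall x v, ext_d L (e1f P 6) x v = e2f P 1 4 x v + e2f P 2 3 x v].

Definition is_h5 (R : realType) (L : nil_algebra R) : Prop :=
  exists P : 'M[R]_6, [/\ P \in unitmx, closed_cof L P,
    forall x v, ext_d L (e1f P 5) x v = e2f P 1 3 x v + e2f P 4 2 x v &
    forall x v, ext_d L (e1f P 6) x v = e2f P 1 4 x v + e2f P 2 3 x v].

Definition has_algebra (R : realType) (b : R) (L : nil_algebra R) : Prop :=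
  [/\ `|b| < 1 -> is_h2 L,
      b = 1 \/ b = -1 -> is_h4 L &
      1 < b ^+ 2 -> is_h5 L].

(* omega^1 = e^1 + i e^2, omega^2 = e^3 + i e^4, omega^3 = (e^5 + i e^6) / t *)
Definition om1 (R : realType) (P : 'M[R]_6) : form R R[i] 1 :=
  fun x v => e1f P 1 x v +i* e1f P 2 x v.
Definition om2 (R : realType) (P : 'M[R]_6) : form R R[i] 1 :=
  fun x v => e1f P 3 x v +i* e1f P 4 x v.
Definition om3 (R : realType) (t : R) (P : 'M[R]_6) : form R R[i] 1 :=
  fun x v => (e1f P 5 x v / t) +i* (e1f P 6 x v / t).

Definition adapted_coframe (R : realType) (L : nil_algebra R) (b t : R)
    (P : 'M[R]_6) : Prop :=
  [/\ P \in unitmx,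
      forall x v, ext_dC L (om1 P) x v = 0,
      forall x v, ext_dC L (om2 P) x v = 0 &
      forall x v, ext_dC L (om3 t P) x v =
        wedge (om1 P) (om2 P) x v + wedge (om1 P) (form_conj (om1 P)) x v
        + b%:C * wedge (om1 P) (form_conj (om2 P)) x v
        - wedge (om2 P) (form_conj (om2 P)) x v].

Definition metric (R : realType) (P : 'M[R]_6) (X Y : vec R) : R :=
  \sum_(k < 6) cof P k.+1 X * cof P k.+1 Y.

(* J E_2 = E_1, J E_4 = E_3, J E_6 = E_5 *)
Definition Jop (R : realType) (P : 'M[R]_6) (X : vec R) : vec R :=
  \sum_(k <- [:: 1; 3; 5]%N)
    (cof P k.+1 X *: frame P (ix k) - cof P k X *: frame P (ix k.+1)).

Definition kahler (R : realType) (P : 'M[R]_6) : form R R 2 :=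
  fun _ v => metric P (v ord0) (Jop P (v ord_max)).

Definition torsion (R : realType) (L : nil_algebra R) (P : 'M[R]_6) :
    form R R 3 :=
  fun x v => - ext_d L (kahler P) x (fun i => Jop P (v i)).

Definition vol (R : realType) (P : 'M[R]_6) : form R R 6 :=
  fun _ v => \det (\matrix_(i < 6, j < 6) (v i *m P) ord0 j).

(* Hodge star of a p-form in dimension p + q, for the volume form [w] and the
   orthonormal frame dual to P: al /\ hodge w al = |al|^2 w. *)
Definition hodge (R : realType) (P : 'M[R]_6) (p q : nat)
    (w : form R R (p + q)) (al : form R R p) : form R R q :=
  fun x v => p`!%:R^-1 * \sum_(I : {ffun 'I_p -> 'I_6})
    al x (fun a => frame P (I a)) *
    w x (fun k => match fintype.split k with
                  | inl a => frame P (I a)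
                  | inr c => v c
                  end).

Definition balanced (R : realType) (L : nil_algebra R) (P : 'M[R]_6) : Prop :=
  forall x v, ext_d L (@hodge R P 2 4 (vol P) (kahler P)) x v = 0.

(* A connection on the tangent bundle: [nab x X Y] is the value at [x] of the
   derivative of the left-invariant field Y in the direction of X. *)
Definition connection (R : realType) := vec R -> vec R -> vec R -> vec R.

Definition covd (R : realType) (L : nil_algebra R) (nab : connection R)
    (X : vec R) (s : vec R -> vec R) (x : vec R) : vec R :=
  lderive L X s x + nab x X (s x).

Definition curv (R : realType) (L : nil_algebra R) (nab : connection R)
    (x X Y Z : vec R) : vec R :=
  covd L nab X (fun y => nab y Y Z) x - covd L nab Y (fun y => nab y X Z) x
  - nab x (bra L X Y) Z.

Definition curv_form (R : realType) (L : nil_algebra R) (P : 'M[R]_6)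
    (nab : connection R) (i j : 'I_6) : form R R 2 :=
  fun x v => metric P (curv L nab x (v ord0) (v ord_max) (frame P j))
                      (frame P i).

Definition pontrjagin (R : realType) (L : nil_algebra R) (P : 'M[R]_6)
    (nab : connection R) : form R R 4 :=
  fun x v => (8 * pi ^+ 2)^-1 *
    \sum_(i < 6) \sum_(j < 6 | (i < j)%N)
      wedge (curv_form L P nab i j) (curv_form L P nab i j) x v.

Definition is_levi_civita (R : realType) (L : nil_algebra R) (P : 'M[R]_6)
    (nab : connection R) : Prop :=
  [/\ forall x a X X' Y, nab x (a *: X + X') Y = a *: nab x X Y + nab x X' Y,
      forall x a X Y Y', nab x X (a *: Y + Y') = a *: nab x X Y + nab x X Y',
      forall x X Y, nab x X Y - nab x Y X = bra L X Y &
      forall x X Y Z, metric P (nab x X Y) Z + metric P Y (nab x X Z) = 0].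

(* Koszul's formula on left-invariant fields, see [levi_civitaP]. *)
Definition levi_civita (R : realType) (L : nil_algebra R) (P : 'M[R]_6) :
    connection R :=
  fun _ X Y => \sum_(k < 6)
    (2^-1 * (metric P (bra L X Y) (frame P k)
             - metric P (bra L Y (frame P k)) X
             + metric P (bra L (frame P k) X) Y)) *: frame P k.

Section LeviCivita.
Context (R : realType) (L : nil_algebra R) (P : 'M[R]_6).

Let metricC X Y : metric P X Y = metric P Y X.
Proof. by apply: eq_bigr => k _; rewrite mulrC. Qed.

Let metricDl a X X' Y :
  metric P (a *: X + X') Y = a * metric P X Y + metric P X' Y.
Proof.
rewrite /metric mulr_sumr -big_split /=; apply: eq_bigr => k _.
by rewrite /cof mulmxDl -scalemxAl !mxE mulrDl mulrA.
Qed.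

Let metric0l Y : metric P 0 Y = 0.
Proof. by rewrite /metric big1 // => k _; rewrite /cof mul0mx mxE mul0r. Qed.

Let metricBl X X' Y : metric P (X - X') Y = metric P X Y - metric P X' Y.
Proof.
by rewrite addrC -scaleN1r metricDl mulN1r addrC.
Qed.

Let metricNl X Y : metric P (- X) Y = - metric P X Y.
Proof. by rewrite -sub0r metricBl metric0l sub0r. Qed.

Let metric_suml (c : 'I_6 -> R) (V : 'I_6 -> vec R) Z :
  metric P (\sum_k c k *: V k) Z = \sum_k c k * metric P (V k) Z.
Proof.
elim/big_rec2: _ => [|k y1 y2 _ <-]; first exact: metric0l.
by rewrite metricDl.
Qed.

Let braC X Y : bra L X Y = - bra L Y X.
Proof.
have := bra_alt L (1 *: X + Y).
rewrite bra_linear_l !bra_linear_r !bra_alt !scale1r add0r addr0.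
by move/eqP; rewrite addr_eq0 => /eqP.
Qed.

Hypothesis P_unit : P \in unitmx.

Let metric_frame X i : metric P X (frame P i) = (X *m P) ord0 i.
Proof.
have frE (k : 'I_6) : cof P k.+1 (frame P i) = (i == k)%:R.
  by rewrite /cof /frame -row_mul mulVmx // /ix inord_val !mxE.
rewrite /metric (bigD1 i) //= big1 => [|k kNi].
  by rewrite frE eqxx mulr1 addr0 /cof /ix inord_val.
by rewrite frE eq_sym (negPf kNi) mulr0.
Qed.

Let frame_sum X : X = \sum_(k < 6) metric P X (frame P k) *: frame P k.
Proof.
rewrite -[LHS](mulmxK P_unit) [LHS]mulmx_sum_row.
by apply: eq_bigr => k _; rewrite metric_frame.
Qed.

Let metric_sum X Z :
  \sum_(k < 6) metric P X (frame P k) * metric P (frame P k) Z = metric P X Z.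
Proof. by rewrite {2}[X]frame_sum metric_suml. Qed.

Let metric_ext X Y : (forall Z, metric P X Z = metric P Y Z) -> X = Y.
Proof.
move=> XY; rewrite [X]frame_sum [Y]frame_sum.
by apply: eq_bigr => k _; rewrite XY.
Qed.

Let koszul x X Y Z : metric P (levi_civita L P x X Y) Z =
  2^-1 * (metric P (bra L X Y) Z - metric P (bra L Y Z) X
          + metric P (bra L Z X) Y).
Proof.
have lin (f : vec R -> R) (fP : forall a U V, f (a *: U + V) = a * f U + f V) :
    \sum_(k < 6) f (frame P k) * metric P (frame P k) Z = f Z.
  have f0 : f 0 = 0.
    by have := fP (-1) 0 0; rewrite scaler0 addr0 mulN1r addNr.
  rewrite [in RHS](frame_sum Z); apply/esym.
  elim/big_rec2: _ => [//|k y1 y2 _ <-].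
  by rewrite fP (metricC Z) mulrC.
rewrite /levi_civita metric_suml.
apply: (lin (fun V => 2^-1 * (metric P (bra L X Y) V - metric P (bra L Y V) X
          + metric P (bra L V X) Y))) => a U V.
rewrite bra_linear_l bra_linear_r !metricDl ![metric P (bra L X Y) _]metricC.
by rewrite metricDl; ring.
Qed.

Lemma levi_civitaP (nab : connection R) : is_levi_civita L P nab <->
  forall x X Y, nab x X Y = levi_civita L P x X Y.
Proof.
split=> [[_ _ tor met] x X Y|nabE].
  apply: metric_ext => Z; rewrite koszul -!(tor x) !metricBl.
  have := met x X Y Z; have := met x Y X Z; have := met x Z X Y.
  rewrite ![metric P X (nab _ _ _)]metricC ![metric P Y (nab _ _ _)]metricC.
  by lra.
split=> [x a X X' Y|x a X Y Y'|x X Y|x X Y Z]; rewrite !nabE.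
- apply: metric_ext => Z; rewrite metricDl !koszul bra_linear_l bra_linear_r.
  by rewrite !metricDl ![metric P _ (_ + _)]metricC metricDl !(metricC X) !(metricC X'); ring.
- apply: metric_ext => Z; rewrite metricDl !koszul bra_linear_l bra_linear_r.
  by rewrite !metricDl ![metric P _ (_ + _)]metricC metricDl !(metricC Y) !(metricC Y'); ring.
- apply: metric_ext => Z; rewrite metricBl !koszul.
  by rewrite (braC Y X) (braC X Z) (braC Z Y) !metricNl; field.
- rewrite (metricC Y) !koszul.
  rewrite (braC X Z) (braC Z Y) (braC Y X) !metricNl.
  by ring.
Qed.

End LeviCivita.

(* g(nabla^+_X Y, E_k) = g(nabla^g_X Y, E_k) + T(X, Y, E_k) / 2 *)
Definition bismut (R : realType) (L : nil_algebra R) (P : 'M[R]_6) :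
    connection R :=
  fun x X Y => levi_civita L P x X Y + \sum_(k < 6)
    (2^-1 * torsion L P x
      (fun i : 'I_3 => [:: X; Y; frame P k]`_i)) *: frame P k.

Definition smooth (R : realType) (f : vec R -> R^o) : Prop :=
  forall (s : seq (vec R)) (x : vec R),
    differentiable (foldr (fun X (h : vec R -> R^o) => 'D_X h) f s) x.

(* A U(1)-bundle with connection on the nilmanifold.  Pulled back to the group,
   which is contractible, the bundle is trivial and the lattice acts on it by
   g (x, u) = (g x, exp (i phase g x) u); the connection is the 1-form d(arg u)
   - pot, and its invariance is [pot_lattice]. *)
Record u1_connection (R : realType) (M : nilmanifold R) := U1Connection {
  pot : form R R 1;
  phase : vec R -> vec R -> R;
  pot_linear : forall x a X Y,
    pot x (fun=> a *: X + Y) = a * pot x (fun=> X) + pot x (fun=> Y);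
  pot_smooth : forall v, smooth (fun x => pot x v);
  phase_smooth : forall g, lattice M g -> smooth (phase g);
  phase_cocycle : forall g h, lattice M g -> lattice M h -> forall x,
    exists n : int, phase (gmul M g h) x =
      phase g (gmul M h x) + phase h x + 2 * pi * n%:~R;
  pot_lattice : forall g, lattice M g -> forall x v,
    pot (gmul M g x) v = pot x v + lderive M (v ord0) (phase g : _ -> R^o) x }.

Definition u1_curv (R : realType) (M : nilmanifold R) (A : u1_connection M) :
  form R R 2 := ext_d M (pot A).

Definition u1_p1 (R : realType) (M : nilmanifold R) (A : u1_connection M) :
    form R R 4 :=
  fun x v => (8 * pi ^+ 2)^-1 * wedge (u1_curv A) (u1_curv A) x v.

(* Primitives of omega^1 and omega^2 on the group: closed left-invariant
   1-forms vanish on brackets, so they are the differentials of the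
   corresponding linear functions in exponential coordinates. *)
Definition z1 (R : realType) (P : 'M[R]_6) (x : vec R) : R[i] :=
  cof P 1 x +i* cof P 2 x.
Definition z2 (R : realType) (P : 'M[R]_6) (x : vec R) : R[i] :=
  cof P 3 x +i* cof P 4 x.

Definition rderive0 (R : realType) (u : R -> R[i]) : R[i] :=
  derive1 (fun s => complex.Re (u s) : R^o) 0
  +i* derive1 (fun s => complex.Im (u s) : R^o) 0.

(* d/dz_k = (d/dx_k - i d/dy_k) / 2 *)
Definition dz1 (R : realType) (h : R[i] -> R[i] -> R[i]) (z w : R[i]) : R[i] :=
  2^-1 * (rderive0 (fun s => h (z + s%:C) w)
          - 'i%C * rderive0 (fun s => h (z + 'i%C * s%:C) w)).
Definition dz2 (R : realType) (h : R[i] -> R[i] -> R[i]) (z w : R[i]) : R[i] :=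
  2^-1 * (rderive0 (fun s => h z (w + s%:C))
          - 'i%C * rderive0 (fun s => h z (w + 'i%C * s%:C))).

Definition expi (R : realType) (a : R) : R[i] := cos a +i* sin a.

Definition abelian_instanton (R : realType) (M : nilmanifold R) (P : 'M[R]_6)
    (A : u1_connection M) : Prop :=
  exists f gam : R[i] -> R[i] -> R,
    let q : R[i] -> R[i] -> R[i] :=
      fun z w => expi (gam z w) * (Num.sqrt (4^-1 - f z w ^+ 2))%:C in
    let q' : R[i] -> R[i] -> R[i] :=
      fun z w => expi (- gam z w) * (Num.sqrt (4^-1 - f z w ^+ 2))%:C in
    [/\ forall z w, `|f z w| <= 2^-1,
        forall x v, (u1_curv A x v)%:C =
          let: z := z1 P x in let: w := z2 P x in
          'i%C * (f z w)%:C * wedge (om1 P) (form_conj (om1 P)) x v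
          - 'i%C * (f z w)%:C * wedge (om2 P) (form_conj (om2 P)) x v
          + q z w * wedge (om1 P) (form_conj (om2 P)) x v
          - q' z w * wedge (om2 P) (form_conj (om1 P)) x v,
        forall z w, 'i%C * dz2 (fun z' w' => (f z' w')%:C) z w + dz1 q' z w = 0 &
        forall z w, 'i%C * dz1 (fun z' w' => (f z' w')%:C) z w + dz2 q z w = 0].

Definition su3_instanton (R : realType) (P : 'M[R]_6) (Om : form R R 2) :=
  (forall x X Y, Om x (vec2 (Jop P X) (Jop P Y)) = Om x (vec2 X Y)) /\
  (forall x, \sum_(k < 6) Om x (vec2 (frame P k) (Jop P (frame P k))) = 0).

Definition hol_su3 (R : realType) (L : nil_algebra R) (P : 'M[R]_6)
    (nab : connection R) : Prop :=
  forall x X Y, \sum_(i < 6)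
    metric P (curv L nab x X Y (Jop P (frame P i))) (frame P i) = 0.

Definition heterotic_susy (R : realType) (M : nilmanifold R) (P : 'M[R]_6)
    (A : u1_connection M) : Prop :=
  [/\ hol_su3 M P (bismut M P), balanced M P & su3_instanton P (u1_curv A)].

(* dT = c (p_1(nab) - p_1(A)) *)
Definition anomaly (R : realType) (M : nilmanifold R) (P : 'M[R]_6)
    (A : u1_connection M) (nab : connection R) (c : R) : Prop :=
  forall x v, ext_d M (torsion M P) x v =
    c * (pontrjagin M P nab x v - u1_p1 A x v).

Definition bianchi (R : realType) (M : nilmanifold R) (P : 'M[R]_6)
    (A : u1_connection M) (nab : connection R) : Prop :=
  exists2 al : R, 0 < al & anomaly P A nab (al / 4 * (8 * pi ^+ 2)).

Definition heterotic_solution (R : realType) (M : nilmanifold R)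
    (P : 'M[R]_6) (A : u1_connection M) : Prop :=
  [/\ heterotic_susy P A,
      exists x v, torsion M P x v != 0,
      bianchi P A (levi_civita M P) &
      bianchi P A (bismut M P)].

(* Main.v *)
Require Import Defs.
From mathcomp Require Import all_boot all_order all_algebra fingroup perm.
From mathcomp Require Import complex ring lra.
From mathcomp Require Import all_classical all_reals all_analysis.

Set Implicit Arguments.
Unset Strict Implicit.
Unset Printing Implicit Defensive.

Import Order.TTheory GRing.Theory Num.Theory.
Import numFieldNormedType.Exports.
Import Defs.

Local Open Scope classical_set_scope.
Local Open Scope ring_scope.

(** Apart from the instanton everything in sight is left-invariant, hence
    determined by the structure constants of an adapted coframe e^1, ..., e^6,
    and both identities compare multiples of the single 4-form e^1234.

    The torsion satisfies dT = - 4 t^2 (b^2 + 3) e^1234 ([ext_d_torsion]), and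
    8 pi^2 p_1 is - 2 t^4 (b^4 + 4 b^2 + 11) e^1234 for the Levi-Civita
    connection and - 8 t^4 (b^4 + 5 b^2 + 10) e^1234 for the Bismut connection
    ([pontrjagin_levi_civita], [pontrjagin_bismut]).  The shape prescribed for
    the curvature F of the abelian connection says that, at every point, F is an
    anti-self-dual form of constant norm in e^1, ..., e^4; therefore F is of type
    (1, 1) and primitive, and 8 pi^2 p_1(A) = F /\ F = - 2 e^1234 whatever the
    functions f and gamma are ([instanton_curv], [u1_p1E]).  Comparing the three
    multiples gives the anomaly equations, and the inequalities on t make both
    denominators, hence both constants alpha', positive.  The remaining equations
    hold because J is parallel for the Bismut connection with
    Omega_12 + Omega_34 + Omega_56 = 0 ([hol_su3_bismut]), and because the Hodge
    dual of the Kaehler form is half its square and the products of e^12 + e^34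
    with de^5 and de^6 vanish ([adapted_balanced]).

    For the last part a solution has to be found on an arbitrary compact quotient,
    and the point is that a U(1)-connection obeys an integrality condition.  The
    three Lie algebras have a common description ([normal_form]): on the plane A^2
    over the algebra A = R[tau] / (tau^2 = s), with s = 1, 0, -1 for h_2, h_4,
    h_5, the bracket is the A-valued determinant.  Linear maps of A^2 thus provide
    many automorphisms, and two generic linear functionals xi, eta on R^4 can be
    completed to a coframe xi, tau xi, eta, tau eta of the same shape
    ([adjusted_normal_form]), which in turn yields, for one explicit value of b in
    each range, an adapted coframe whose e^1 and e^3 are multiples of xi and eta
    ([normal_form_adapted]).  For f = gamma = 0 the required curvature e^13 + e^24
    is 2 / (1 - b) e^13 plus the differential of an invariant 1-form, so that the
    only obstruction to a connection with this curvature is the integrality of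
    e^13 on the lattice, suitably normalized ([constant_instanton]).

    This is achieved by choosing xi and eta integral on the lattice up to a common
    denominator, and then rescaling them.  Such functionals exist because the
    projection of the lattice to R^4 is again a lattice: it spans by
    cocompactness, and it is discrete because the commutator of a lattice element
    with small projection and a fixed lattice element is a small lattice element
    ([projected_lattice_discrete]).  A discrete subgroup of R^4 consists of
    rational combinations, with bounded denominators, of any basis taken in it, by
    the pigeonhole principle ([discrete_integral]).  Genericity is a polynomial
    condition, which can be met at integral coefficients ([nat_point]). *)

(** * Alternating sums over permutations *)

Lemma sum_perm_ord0 (K : zmodType) n (F : 'S_n.+1 -> K) :
  \sum_s F s = \sum_(i < n.+1) \sum_(s : 'S_n) F (lift_perm ord0 i s).
Proof.
rewrite pair_big /= (reindex (fun p : 'I_n.+1 * 'S_n => lift_perm ord0 p.1 p.2)) //.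
apply/onW_bij/inj_card_bij => [[i s] [j u] /= /permP eq_su|]; last first.
  by rewrite card_prod card_ord !card_Sn factS.
have eq_ij : i = j by have := eq_su ord0; rewrite !lift_perm_id.
congr pair => //; apply/permP => k; apply: (@lift_inj _ i).
by have := eq_su (lift ord0 k); rewrite !lift_perm_lift eq_ij.
Qed.

Definition alt (K : pzRingType) (V : Type) n (Phi : ('I_n -> V) -> K) (v : 'I_n -> V) :=
  \sum_(s : 'S_n) (-1) ^+ (s : bool) * Phi (v \o s).

Definition fcons (V : Type) n (a : V) (w : 'I_n -> V) (i : 'I_n.+1) : V :=
  if unlift ord0 i is Some j then w j else a.

(** Laplace expansion along the first argument, the device by which wedge products
    and determinants of small degree are made explicit. *)
Lemma alt_recl (K : pzRingType) (V : Type) n (Phi : ('I_n.+1 -> V) -> K) v :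
  alt Phi v = \sum_(i < n.+1) (-1) ^+ i *
    alt (fun w => Phi (fcons (v i) w)) (fun k => v (lift i k)).
Proof.
rewrite /alt sum_perm_ord0; apply: eq_bigr => i _.
rewrite mulr_sumr; apply: eq_bigr => s _.
rewrite odd_lift_perm /= signr_addb signr_odd mulrA; congr (_ * Phi _).
apply/funext => k; rewrite /fcons /=.
by case: unliftP => [j ->|->]; rewrite ?lift_perm_lift ?lift_perm_id.
Qed.

Lemma alt0 (K : pzRingType) (V : Type) (Phi : ('I_0 -> V) -> K) v : alt Phi v = Phi v.
Proof.
rewrite /alt (bigD1 1%g) //= big1 ?addr0 => [|s].
  by rewrite odd_perm1 mul1r; congr Phi; apply/funext => -[].
by case/eqP; apply/permP => -[].
Qed.

Lemma fcons0 (V : Type) n (a : V) (w : 'I_n -> V) : fcons a w ord0 = a.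
Proof. by rewrite /fcons unlift_none. Qed.

Lemma fconsS (V : Type) n (a : V) (w : 'I_n -> V) i : fcons a w (lift ord0 i) = w i.
Proof. by rewrite /fcons liftK. Qed.

Lemma lift_lift0 n (i : 'I_n.+1) : lift (lift ord0 i) ord0 = ord0.
Proof. exact: val_inj. Qed.

Lemma lift_liftS n (i : 'I_n.+1) (j : 'I_n) :
  lift (lift ord0 i) (lift ord0 j) = lift ord0 (lift i j).
Proof. by apply: val_inj; rewrite /= /bump !add1n ltnS addnS. Qed.

Local Notation o0 := ord0.
Local Notation o1 := (lift ord0 ord0).
Local Notation o2 := (lift ord0 (lift ord0 ord0)).
Local Notation o3 := (lift ord0 (lift ord0 (lift ord0 ord0))).
Local Notation o4 := (lift ord0 (lift ord0 (lift ord0 (lift ord0 ord0)))).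
Local Notation o5 := (lift ord0 (lift ord0 (lift ord0 (lift ord0 (lift ord0 ord0))))).

Lemma wedge_alt (R : realType) (K : numFieldType) p q (al : form R K p)
    (be : form R K q) x v :
  wedge al be x v = (p`! * q`!)%:R^-1 *
    alt (fun w => al x (fun i => w (@lshift p q i)) * be x (fun i => w (@rshift p q i))) v.
Proof.
by rewrite /wedge /alt; congr (_ * _); apply: eq_bigr => s _; rewrite mulrA.
Qed.

Lemma wedge11 (R : realType) (K : numFieldType) (al be : form R K 1)
    (a b : vec R -> K) x (v : 'I_2 -> vec R) :
  (forall v, al x v = a (v o0)) -> (forall v, be x v = b (v o0)) ->
  wedge al be x v = a (v o0) * b (v o1) - a (v o1) * b (v o0).
Proof.
move=> al_a be_b; rewrite wedge_alt muln1 invr1 mul1r.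
rewrite (_ : (fun _ => _) = fun w : 'I_2 -> vec R => a (w o0) * b (w o1)); last first.
  by apply/funext => w; rewrite al_a be_b /=; congr (a (w _) * b (w _)); apply: val_inj.
rewrite !(alt_recl, big_ord_recl, big_ord0, addr0) !alt0.
rewrite !(fcons0, fconsS, lift_lift0, lift_liftS) /= /bump /=; ring.
Qed.

Lemma alt4 (K : comPzRingType) (V : Type) (phi : V -> V -> V -> V -> K) (v : 'I_4 -> V)
    (p := fun i j k l => phi (v i) (v j) (v k) (v l)) :
  alt (fun w : 'I_4 -> V => phi (w o0) (w o1) (w o2) (w o3)) v =
    p o0 o1 o2 o3 - p o0 o1 o3 o2 - p o0 o2 o1 o3 + p o0 o2 o3 o1 + p o0 o3 o1 o2
    - p o0 o3 o2 o1 - p o1 o0 o2 o3 + p o1 o0 o3 o2 + p o1 o2 o0 o3 - p o1 o2 o3 o0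
    - p o1 o3 o0 o2 + p o1 o3 o2 o0 + p o2 o0 o1 o3 - p o2 o0 o3 o1 - p o2 o1 o0 o3
    + p o2 o1 o3 o0 + p o2 o3 o0 o1 - p o2 o3 o1 o0 - p o3 o0 o1 o2 + p o3 o0 o2 o1
    + p o3 o1 o0 o2 - p o3 o1 o2 o0 - p o3 o2 o0 o1 + p o3 o2 o1 o0.
Proof.
rewrite !(alt_recl, big_ord_recl, big_ord0, addr0) !alt0.
rewrite !(fcons0, fconsS, lift_lift0, lift_liftS) /= /bump /= /p; ring.
Qed.

Lemma wedge22 (R : realType) (K : numFieldType) (al be : form R K 2)
    (a b : vec R -> vec R -> K) x (v : 'I_4 -> vec R) :
  (forall v, al x v = a (v o0) (v o1)) -> (forall v, be x v = b (v o0) (v o1)) ->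
  (forall X Y, a X Y = - a Y X) -> (forall X Y, b X Y = - b Y X) ->
  wedge al be x v =
    a (v o0) (v o1) * b (v o2) (v o3) - a (v o0) (v o2) * b (v o1) (v o3)
    + a (v o0) (v o3) * b (v o1) (v o2) + a (v o1) (v o2) * b (v o0) (v o3)
    - a (v o1) (v o3) * b (v o0) (v o2) + a (v o2) (v o3) * b (v o0) (v o1).
Proof.
move=> al_a be_b aC bC; rewrite wedge_alt.
rewrite (_ : (fun _ => _) =
    fun w : 'I_4 -> vec R => a (w o0) (w o1) * b (w o2) (w o3)); last first.
  apply/funext => w; rewrite al_a be_b /=.
  by congr (a (w _) (w _) * b (w _) (w _)); apply: val_inj.
rewrite (alt4 (fun X Y Z W => a X Y * b Z W)).
rewrite ![a (v o1) (v o0)]aC ![a (v o2) (v o0)]aC ![a (v o3) (v o0)]aC.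
rewrite ![a (v o2) (v o1)]aC ![a (v o3) (v o1)]aC ![a (v o3) (v o2)]aC.
rewrite ![b (v o1) (v o0)]bC ![b (v o2) (v o0)]bC ![b (v o3) (v o0)]bC.
rewrite ![b (v o2) (v o1)]bC ![b (v o3) (v o1)]bC ![b (v o3) (v o2)]bC.
by rewrite (_ : (2`! * 2`!)%N = 4) //; field.
Qed.

(** * The differential of left-invariant forms *)

Lemma lderive_cst (R : realType) (W : normedModType R) (L : nil_algebra R) X (c : W) x :
  lderive L X (fun=> c) x = 0.
Proof. exact: derive_cst. Qed.

Section InvariantDifferential.
Context (R : realType) (L : nil_algebra R).

(** For a left-invariant form the terms of Cartan's formula that differentiate
    vanish, and only the brackets remain. *)
Lemma ext_d_inv p (al : form R R p) (a : ('I_p -> vec R) -> R) x v :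
  (forall x v, al x v = a v) ->
  ext_d L al x v = \sum_(i < p.+1) \sum_(j < p.+1) if (i < j)%N then (-1) ^+ j *
    a (fun k => if lift j k == i then bra L (v i) (v j) else v (lift j k)) else 0.
Proof.
move=> al_a; rewrite /ext_d big1 ?add0r => [|i _].
  by apply: eq_bigr => i _; rewrite big_mkcond; apply: eq_bigr => j _; rewrite al_a.
rewrite (_ : (fun y => _) = fun=> a (fun k => v (lift i k)) :> R^o).
  by rewrite (@lderive_cst R R^o) mulr0.
by apply/funext => y; rewrite al_a.
Qed.

Let lift0_eq n (i j : 'I_n) : (lift ord0 i == lift ord0 j) = (i == j).
Proof. exact: (inj_eq (@lift_inj n.+1 ord0)). Qed.

Let eq_lift0 n (i : 'I_n) : (ord0 == lift ord0 i) = false.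
Proof. by []. Qed.

Let lift0_neq n (i : 'I_n) : (lift ord0 i == ord0) = false.
Proof. by []. Qed.

Let ordE := (lift_lift0, lift_liftS, lift0_eq, eq_lift0, lift0_neq, eqxx).

Lemma ext_d1 (al : form R R 1) (a : vec R -> R) x v :
  (forall x v, al x v = a (v o0)) ->
  ext_d L al x v = - a (bra L (v o0) (v o1)).
Proof.
move=> al_a; rewrite (ext_d_inv _ _ al_a).
by rewrite !(big_ord_recl, big_ord0, ordE) /= /bump /= !addr0 !add0r mulN1r.
Qed.

Lemma ext_d2 (al : form R R 2) (a : vec R -> vec R -> R) x v :
  (forall x v, al x v = a (v o0) (v o1)) ->
  ext_d L al x v = - a (bra L (v o0) (v o1)) (v o2)
    + a (bra L (v o0) (v o2)) (v o1) + a (v o0) (bra L (v o1) (v o2)).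
Proof.
move=> al_a; rewrite (ext_d_inv _ _ al_a).
rewrite !(big_ord_recl, big_ord0, ordE) /= /bump /=; ring.
Qed.

Lemma ext_d3 (al : form R R 3) (a : vec R -> vec R -> vec R -> R) x v :
  (forall x v, al x v = a (v o0) (v o1) (v o2)) ->
  ext_d L al x v = - a (bra L (v o0) (v o1)) (v o2) (v o3)
    + a (bra L (v o0) (v o2)) (v o1) (v o3) + a (v o0) (bra L (v o1) (v o2)) (v o3)
    - a (bra L (v o0) (v o3)) (v o1) (v o2) - a (v o0) (bra L (v o1) (v o3)) (v o2)
    - a (v o0) (v o1) (bra L (v o2) (v o3)).
Proof.
move=> al_a; rewrite (ext_d_inv _ _ al_a).
rewrite !(big_ord_recl, big_ord0, ordE) /= /bump /=; ring.
Qed.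

Lemma ext_d4 (al : form R R 4) (a : vec R -> vec R -> vec R -> vec R -> R) x v :
  (forall x v, al x v = a (v o0) (v o1) (v o2) (v o3)) ->
  ext_d L al x v = - a (bra L (v o0) (v o1)) (v o2) (v o3) (v o4)
    + a (bra L (v o0) (v o2)) (v o1) (v o3) (v o4)
    + a (v o0) (bra L (v o1) (v o2)) (v o3) (v o4)
    - a (bra L (v o0) (v o3)) (v o1) (v o2) (v o4)
    - a (v o0) (bra L (v o1) (v o3)) (v o2) (v o4)
    - a (v o0) (v o1) (bra L (v o2) (v o3)) (v o4)
    + a (bra L (v o0) (v o4)) (v o1) (v o2) (v o3)
    + a (v o0) (bra L (v o1) (v o4)) (v o2) (v o3)
    + a (v o0) (v o1) (bra L (v o2) (v o4)) (v o3)
    + a (v o0) (v o1) (v o2) (bra L (v o3) (v o4)).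
Proof.
move=> al_a; rewrite (ext_d_inv _ _ al_a).
rewrite !(big_ord_recl, big_ord0, ordE) /= /bump /=; ring.
Qed.

End InvariantDifferential.

(** * Coordinates in a coframe *)

Lemma ix_eq k l : (0 < k < 7)%N -> (0 < l < 7)%N -> (ix k == ix l) = (k == l).
Proof.
move=> /andP[k0 k7] /andP[l0 l7]; rewrite -val_eqE /= !inordK ?prednK //.
by rewrite -eqSS !prednK.
Qed.

Section Coordinates.
Context (R : realType) (P : 'M[R]_6).

Lemma cofDZ k a X Y : cof P k (a *: X + Y) = a * cof P k X + cof P k Y.
Proof. by rewrite /cof mulmxDl -scalemxAl !mxE. Qed.

Lemma cof0 k : cof P k 0 = 0.
Proof. by rewrite /cof mul0mx mxE. Qed.

Lemma cofZ k a X : cof P k (a *: X) = a * cof P k X.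
Proof. by rewrite -[a *: X]addr0 cofDZ cof0 addr0. Qed.

Lemma cofD k X Y : cof P k (X + Y) = cof P k X + cof P k Y.
Proof. by rewrite -[X]scale1r cofDZ mul1r scale1r. Qed.

Lemma cofN k X : cof P k (- X) = - cof P k X.
Proof. by rewrite -scaleN1r cofZ mulN1r. Qed.

Lemma cofB k X Y : cof P k (X - Y) = cof P k X - cof P k Y.
Proof. by rewrite cofD cofN. Qed.

Lemma cof_ord (i : 'I_6) X : cof P i.+1 X = (X *m P) ord0 i.
Proof. by rewrite /cof /ix inord_val. Qed.

Lemma metricE X Y : metric P X Y = cof P 1 X * cof P 1 Y + cof P 2 X * cof P 2 Y
  + cof P 3 X * cof P 3 Y + cof P 4 X * cof P 4 Y + cof P 5 X * cof P 5 Y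
  + cof P 6 X * cof P 6 Y.
Proof. by rewrite /metric !big_ord_recr big_ord0 /= add0r. Qed.

Hypothesis P_unit : P \in unitmx.

Lemma cof_frame k i : cof P k (frame P i) = (i == ix k)%:R.
Proof. by rewrite /cof /frame -row_mul mulVmx // !mxE. Qed.

Lemma cof_sum k (c : 'I_6 -> R) : cof P k (\sum_i c i *: frame P i) = c (ix k).
Proof.
have -> : cof P k (\sum_i c i *: frame P i) = \sum_i c i * cof P k (frame P i).
  by elim/big_rec2: _ => [|i y1 y2 _ <-]; rewrite ?cof0 // cofDZ.
rewrite (bigD1 (ix k)) //= big1 => [|i iNk]; rewrite cof_frame ?eqxx ?mulr1 ?addr0 //.
by rewrite (negPf iNk) mulr0.
Qed.

Lemma cof_inj X Y : (forall i : 'I_6, cof P i.+1 X = cof P i.+1 Y) -> X = Y.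
Proof.
move=> eqXY; rewrite -[X](mulmxK P_unit) -[Y](mulmxK P_unit); congr (_ *m _).
by apply/rowP => i; rewrite -!cof_ord.
Qed.

Lemma metric_frame X (i : 'I_6) : metric P X (frame P i) = cof P i.+1 X.
Proof.
rewrite /metric (bigD1 i) //= big1 => [|k kNi].
  by rewrite cof_frame /ix inord_val eqxx mulr1 addr0.
by rewrite cof_frame /ix inord_val eq_sym (negPf kNi) mulr0.
Qed.

(** In coordinates [J] is the rotation (x, y) -> (y, - x) in each of the three
    planes of the coframe. *)
Lemma cof_J X :
  (cof P 1 (Jop P X) = cof P 2 X) * (cof P 2 (Jop P X) = - cof P 1 X) *
  (cof P 3 (Jop P X) = cof P 4 X) * (cof P 4 (Jop P X) = - cof P 3 X) *
  (cof P 5 (Jop P X) = cof P 6 X) * (cof P 6 (Jop P X) = - cof P 5 X).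
Proof.
rewrite /Jop !big_cons big_nil addr0 !(cofD, cofN, cofZ, cof_frame).
by rewrite !ix_eq //=; split; [split; [split; [split; [split|]|]|]|]; ring.
Qed.

End Coordinates.

(** The 2-form e^i /\ e^j. *)
Definition ee (R : realType) (P : 'M[R]_6) i j X Y : R :=
  cof P i X * cof P j Y - cof P j X * cof P i Y.

(** de^k(X, Y) = - e^k([X, Y]), so these are the real structure equations of an
    adapted coframe, see [adapted_coframeP]. *)
Definition structure_eqs (R : realType) (L : nil_algebra R) (b t : R) (P : 'M[R]_6) :=
  forall X Y, [/\
    [/\ cof P 1 (bra L X Y) = 0, cof P 2 (bra L X Y) = 0,
      cof P 3 (bra L X Y) = 0 & cof P 4 (bra L X Y) = 0],
    cof P 5 (bra L X Y) = - t * ((b + 1) * ee P 1 3 X Y + (b - 1) * ee P 2 4 X Y) &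
    cof P 6 (bra L X Y) = - t * (- 2 * ee P 1 2 X Y - (b - 1) * ee P 1 4 X Y
      + (b + 1) * ee P 2 3 X Y + 2 * ee P 3 4 X Y)].

Lemma ext_d_e1f (R : realType) (L : nil_algebra R) (P : 'M[R]_6) k x v :
  ext_d L (e1f P k) x v = - cof P k (bra L (v o0) (v o1)).
Proof. exact: ext_d1. Qed.

Section Adapted.
Local Open Scope complex_scope.
Context (R : realType) (L : nil_algebra R) (P : 'M[R]_6).

Lemma ext_dC_om (k l : nat) x v :
  ext_dC L (fun x v => e1f P k x v +i* e1f P l x v) x v =
  (- cof P k (bra L (v o0) (v o1))) +i* (- cof P l (bra L (v o0) (v o1))).
Proof. by rewrite /ext_dC /= (ext_d_e1f L P k) (ext_d_e1f L P l). Qed.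

Lemma wedge_om (al be : form R R[i] 1) (a b c d : vec R -> R) x v :
  (forall v, al x v = a (v o0) +i* b (v o0)) ->
  (forall v, be x v = c (v o0) +i* d (v o0)) ->
  wedge al be x v =
    (a (v o0) * c (v o1) - b (v o0) * d (v o1) - a (v o1) * c (v o0) + b (v o1) * d (v o0))
    +i* (a (v o0) * d (v o1) + b (v o0) * c (v o1)
         - a (v o1) * d (v o0) - b (v o1) * c (v o0)).
Proof.
move=> alE beE; rewrite (wedge11 (a := fun X => a X +i* b X) (b := fun X => c X +i* d X)) //.
by apply/eqP; rewrite eq_complex /=; apply/andP; split; apply/eqP; ring.
Qed.

Lemma adapted_coframeP b t : t != 0 ->
  adapted_coframe L b t P <-> P \in unitmx /\ structure_eqs L b t P.
Proof.
move=> t0; have om3E x v : ext_dC L (om3 t P) x v =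
  (- (cof P 5 (bra L (v o0) (v o1)) / t)) +i* (- (cof P 6 (bra L (v o0) (v o1)) / t)).
  rewrite /ext_dC /om3 /=.
  by congr (_ +i* _); [apply: (ext_d1 L (a := fun X => cof P 5 X / t))
    | apply: (ext_d1 L (a := fun X => cof P 6 X / t))].
have om12E := @wedge_om (om1 P) (om2 P) (cof P 1) (cof P 2) (cof P 3) (cof P 4).
have om11E := @wedge_om (om1 P) (form_conj (om1 P))
  (cof P 1) (cof P 2) (cof P 1) (fun X => - cof P 2 X).
have om1bE := @wedge_om (om1 P) (form_conj (om2 P))
  (cof P 1) (cof P 2) (cof P 3) (fun X => - cof P 4 X).
have om22E := @wedge_om (om2 P) (form_conj (om2 P))
  (cof P 3) (cof P 4) (cof P 3) (fun X => - cof P 4 X).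
split=> [[P_unit d1 d2 d3]|[P_unit dP]]; split=> //.
- move=> X Y; move: (d1 0 (vec2 X Y)) (d2 0 (vec2 X Y)) (d3 0 (vec2 X Y)).
  rewrite /om1 /om2 !ext_dC_om om3E om12E // om11E // om1bE // om22E // /vec2 /=.
  move=> [/eqP + /eqP +] [/eqP + /eqP +] [].
  rewrite !oppr_eq0 => /eqP -> /eqP -> /eqP -> /eqP -> d5 d6; rewrite /ee; split=> //.
    by rewrite -[LHS](divfK t0) -[LHS]opprK -mulNr d5; ring.
  by rewrite -[LHS](divfK t0) -[LHS]opprK -mulNr d6; ring.
- move=> x v; rewrite /om1 ext_dC_om.
  by have [[-> -> _ _] _ _] := dP (v o0) (v o1); rewrite oppr0.
- move=> x v; rewrite /om2 ext_dC_om.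
  by have [[_ _ -> ->] _ _] := dP (v o0) (v o1); rewrite oppr0.
- move=> x v; rewrite om3E om12E // om11E // om1bE // om22E //.
  have [_ -> ->] := dP (v o0) (v o1); rewrite /ee.
  by apply/eqP; rewrite eq_complex /=; apply/andP; split; apply/eqP; field.
Qed.

End Adapted.

(** * Torsion *)

(** The Pfaffian of the matrix of values of a 2-form on four vectors, that is, half
    the value of its square. *)
Definition pf (R : realType) (a : vec R -> vec R -> R) X Y Z W : R :=
  a X Y * a Z W - a X Z * a Y W + a X W * a Y Z.

(** The 4-form e^i /\ e^j /\ e^k /\ e^l, as the product of e^ij and e^kl. *)
Definition ee4 (R : realType) (P : 'M[R]_6) i j k l X Y Z W : R :=
  ee P i j X Y * ee P k l Z W - ee P i j X Z * ee P k l Y W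
  + ee P i j X W * ee P k l Y Z + ee P i j Y Z * ee P k l X W
  - ee P i j Y W * ee P k l X Z + ee P i j Z W * ee P k l X Y.

(** T is a combination al5 /\ e^5 + al6 /\ e^6, as [J] preserves the span of e^5
    and e^6. *)
Definition torsion3 (R : realType) (P : 'M[R]_6) (b t : R) (X Y Z : vec R) : R :=
  let al5 X Y := (b - 1) * ee P 1 3 X Y + (b + 1) * ee P 2 4 X Y in
  let al6 X Y := - 2 * ee P 1 2 X Y - (b + 1) * ee P 1 4 X Y
    + (b - 1) * ee P 2 3 X Y + 2 * ee P 3 4 X Y in
  t * (al5 X Y * cof P 5 Z + al5 Y Z * cof P 5 X + al5 Z X * cof P 5 Y
     + al6 X Y * cof P 6 Z + al6 Y Z * cof P 6 X + al6 Z X * cof P 6 Y).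

Section Torsion.
Context (R : realType) (L : nil_algebra R) (b t : R) (P : 'M[R]_6).
Local Notation "X @_ k" := (cof P k X) (at level 2, k at level 0, format "X @_ k").
Hypotheses (P_unit : P \in unitmx) (dP : structure_eqs L b t P).

Lemma cof_bra X Y :
  ((bra L X Y)@_1 = 0) * ((bra L X Y)@_2 = 0) * ((bra L X Y)@_3 = 0) *
  ((bra L X Y)@_4 = 0) *
  ((bra L X Y)@_5 = - t * ((b + 1) * ee P 1 3 X Y + (b - 1) * ee P 2 4 X Y)) *
  ((bra L X Y)@_6 = - t * (- 2 * ee P 1 2 X Y - (b - 1) * ee P 1 4 X Y
      + (b + 1) * ee P 2 3 X Y + 2 * ee P 3 4 X Y)).
Proof. by have [[-> -> -> ->] -> ->] := dP X Y. Qed.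

Lemma kahlerE x v : kahler P x v =
  ee P 1 2 (v o0) (v o1) + ee P 3 4 (v o0) (v o1) + ee P 5 6 (v o0) (v o1).
Proof.
rewrite /kahler (_ : ord_max = o1); last exact: val_inj.
by rewrite metricE !(cof_J P_unit) /ee; ring.
Qed.

Lemma torsionE x v : torsion L P x v = torsion3 P b t (v o0) (v o1) (v o2).
Proof.
rewrite /torsion (ext_d2 L (a := fun X Y => ee P 1 2 X Y + ee P 3 4 X Y + ee P 5 6 X Y)).
  by rewrite /torsion3 /ee !cof_bra /ee !(cof_J P_unit); ring.
exact: kahlerE.
Qed.

Lemma ext_d_torsion x v : ext_d L (torsion L P) x v =
  - (4 * t ^+ 2 * (b ^+ 2 + 3)) * ee4 P 1 2 3 4 (v o0) (v o1) (v o2) (v o3).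
Proof.
rewrite (ext_d3 L (a := torsion3 P b t)); last exact: torsionE.
by rewrite /torsion3 /ee4 /ee !cof_bra /ee; ring.
Qed.

End Torsion.

Lemma cof_frame_ix (R : realType) (P : 'M[R]_6) (k : nat) (fr := frame P (ix k)) :
  P \in unitmx -> (0 < k < 7)%N ->
  (cof P 1 fr = (k == 1)%:R) * (cof P 2 fr = (k == 2)%:R) * (cof P 3 fr = (k == 3)%:R) *
  (cof P 4 fr = (k == 4)%:R) * (cof P 5 fr = (k == 5)%:R) * (cof P 6 fr = (k == 6)%:R) :> Type.
Proof. by move=> P_unit k7; rewrite /fr !cof_frame // !ix_eq. Qed.

(** * Curvature and Pontrjagin forms *)

Section Curvature.
Context (R : realType) (P : 'M[R]_6).
Local Notation "X @_ k" := (cof P k X) (at level 2, k at level 0, format "X @_ k").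

(** The covariant derivative of a left-invariant field along a left-invariant field
    is left-invariant, hence the usual algebraic expression of the curvature. *)
Lemma curv_inv (L : nil_algebra R) (nab : connection R) x X Y Z :
  (forall y X Y, nab y X Y = nab 0 X Y) ->
  curv L nab x X Y Z = nab 0 X (nab 0 Y Z) - nab 0 Y (nab 0 X Z) - nab 0 (bra L X Y) Z.
Proof.
move=> nab0; rewrite /curv /covd.
have nabC W : (fun y => nab y W Z) = fun=> nab 0 W Z by apply/funext.
by rewrite (nabC X) (nabC Y) !lderive_cst !add0r !(nab0 x).
Qed.

Lemma pontrjaginE (L : nil_algebra R) (nab : connection R)
    (Om : nat -> nat -> vec R -> vec R -> R) x v :
  (forall (i j : 'I_6) x v, (i < j)%N ->
    curv_form L P nab i j x v = Om i.+1 j.+1 (v o0) (v o1)) ->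
  (forall i j X Y, Om i j X Y = - Om i j Y X) ->
  pontrjagin L P nab x v = (8 * pi ^+ 2)^-1 * \sum_(i < 6) \sum_(j < 6 | (i < j)%N)
    2 * pf (Om i.+1 j.+1) (v o0) (v o1) (v o2) (v o3).
Proof.
move=> OmE OmC; rewrite /pontrjagin; congr (_ * _).
apply: eq_bigr => i _; apply: eq_bigr => j ij.
rewrite (wedge22 (a := Om i.+1 j.+1) (b := Om i.+1 j.+1)) //.
- by rewrite /pf; ring.
- by move=> w; apply: OmE.
- by move=> w; apply: OmE.
Qed.

(** The curvature forms Omega^i_j of the two connections, for i < j; the entries with
    i >= j are set to 0. *)
Definition levi_civita_curv (b t : R) (i j : nat) (X Y : vec R) : R :=
  (t / 2) ^+ 2 *
  match i, j with
  | 1, 2 => 6 * (b + 1) * ee P 2 3 X Y - 12 * ee P 1 2 X Y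
      - 6 * (b - 1) * ee P 1 4 X Y - 2 * (b ^+ 2 - 5) * ee P 3 4 X Y
      - 2 * (b ^+ 2 + 1) * ee P 5 6 X Y
  | 1, 3 => - (3 * (b + 1) ^+ 2 * ee P 1 3 X Y) - (b ^+ 2 - 5) * ee P 2 4 X Y
  | 1, 4 => (b ^+ 2 - 5) * ee P 2 3 X Y + 6 * (b - 1) * ee P 3 4 X Y
      + 4 * b * ee P 5 6 X Y - 6 * (b - 1) * ee P 1 2 X Y
      - 3 * (b - 1) ^+ 2 * ee P 1 4 X Y
  | 1, 5 => (b + 1) ^+ 2 * ee P 1 5 X Y + 2 * (b - 1) * ee P 4 6 X Y
      - (b - 1) ^+ 2 * ee P 2 6 X Y
  | 1, 6 => (b ^+ 2 - 2 * b + 5) * ee P 1 6 X Y + (b + 1) ^+ 2 * ee P 2 5 X Y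
      + 4 * ee P 3 6 X Y - 2 * (b + 1) * ee P 4 5 X Y
  | 2, 3 => 6 * (b + 1) * ee P 1 2 X Y + (b ^+ 2 - 5) * ee P 1 4 X Y
      - 3 * (b + 1) ^+ 2 * ee P 2 3 X Y - 6 * (b + 1) * ee P 3 4 X Y
      - 4 * b * ee P 5 6 X Y
  | 2, 4 => - ((b ^+ 2 - 5) * ee P 1 3 X Y) - 3 * (b - 1) ^+ 2 * ee P 2 4 X Y
  | 2, 5 => (b + 1) ^+ 2 * ee P 1 6 X Y + (b - 1) ^+ 2 * ee P 2 5 X Y
      - 2 * (b + 1) * ee P 3 6 X Y
  | 2, 6 => (b ^+ 2 + 2 * b + 5) * ee P 2 6 X Y + 2 * (b - 1) * ee P 3 5 X Y
      - (b - 1) ^+ 2 * ee P 1 5 X Y - 4 * ee P 4 6 X Y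
  | 3, 4 => 6 * (b - 1) * ee P 1 4 X Y + 2 * (b + 1) * (b - 1) * ee P 5 6 X Y
      - 2 * (b ^+ 2 - 5) * ee P 1 2 X Y - 6 * (b + 1) * ee P 2 3 X Y
      - 12 * ee P 3 4 X Y
  | 3, 5 => 2 * (b - 1) * ee P 2 6 X Y + (b + 1) ^+ 2 * ee P 3 5 X Y
      + (b + 1) * (b - 1) * ee P 4 6 X Y
  | 3, 6 => 4 * ee P 1 6 X Y + (b ^+ 2 + 2 * b + 5) * ee P 3 6 X Y
      - 2 * (b + 1) * ee P 2 5 X Y - (b + 1) * (b - 1) * ee P 4 5 X Y
  | 4, 5 => (b - 1) ^+ 2 * ee P 4 5 X Y - 2 * (b + 1) * ee P 1 6 X Y
      - (b + 1) * (b - 1) * ee P 3 6 X Y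
  | 4, 6 => 2 * (b - 1) * ee P 1 5 X Y + (b + 1) * (b - 1) * ee P 3 5 X Y
      + (b ^+ 2 - 2 * b + 5) * ee P 4 6 X Y - 4 * ee P 2 6 X Y
  | 5, 6 => 4 * b * ee P 1 4 X Y + 2 * (b + 1) * (b - 1) * ee P 3 4 X Y
      - 2 * (b ^+ 2 + 1) * ee P 1 2 X Y - 4 * b * ee P 2 3 X Y
  | _, _ => 0
  end.

Definition bismut_curv (b t : R) (i j : nat) (X Y : vec R) : R :=
  t ^+ 2 *
  match i, j with
  | 1, 2 => 2 * (b + 1) * ee P 2 3 X Y + 6 * ee P 3 4 X Y - 4 * ee P 1 2 X Y
      - 2 * (b - 1) * ee P 1 4 X Y - 2 * b ^+ 2 * ee P 5 6 X Y
  | 1, 3 => - ((b ^+ 2 + b + 1) * ee P 1 3 X Y)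
      - (b ^+ 2 - b + 1) * ee P 2 4 X Y
  | 1, 4 => (b ^+ 2 + b + 1) * ee P 2 3 X Y + 2 * b * ee P 3 4 X Y
      + 4 * b * ee P 5 6 X Y - 2 * b * ee P 1 2 X Y
      - (b ^+ 2 - b + 1) * ee P 1 4 X Y
  | 1, 5 => b * ee P 1 5 X Y + b * ee P 2 6 X Y - 2 * ee P 4 6 X Y
  | 1, 6 => b * ee P 2 5 X Y + 2 * ee P 3 6 X Y - b * ee P 1 6 X Y
  | 2, 3 => 2 * b * ee P 1 2 X Y + (b ^+ 2 - b + 1) * ee P 1 4 X Y
      - (b ^+ 2 + b + 1) * ee P 2 3 X Y - 2 * b * ee P 3 4 X Y
      - 4 * b * ee P 5 6 X Y
  | 2, 4 => - ((b ^+ 2 + b + 1) * ee P 1 3 X Y)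
      - (b ^+ 2 - b + 1) * ee P 2 4 X Y
  | 2, 5 => b * ee P 1 6 X Y - b * ee P 2 5 X Y - 2 * ee P 3 6 X Y
  | 2, 6 => b * ee P 1 5 X Y + b * ee P 2 6 X Y - 2 * ee P 4 6 X Y
  | 3, 4 => 6 * ee P 1 2 X Y + 2 * (b - 1) * ee P 1 4 X Y
      + 2 * b ^+ 2 * ee P 5 6 X Y - 2 * (b + 1) * ee P 2 3 X Y
      - 4 * ee P 3 4 X Y
  | 3, 5 => b * ee P 3 5 X Y - 2 * ee P 2 6 X Y - b * ee P 4 6 X Y
  | 3, 6 => 2 * ee P 1 6 X Y + b * ee P 3 6 X Y + b * ee P 4 5 X Y
  | 4, 5 => - (2 * ee P 1 6 X Y) - b * ee P 3 6 X Y - b * ee P 4 5 X Y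
  | 4, 6 => b * ee P 3 5 X Y - 2 * ee P 2 6 X Y - b * ee P 4 6 X Y
  | 5, 6 => - (2 * ee P 1 2 X Y) - 2 * ee P 3 4 X Y
  | _, _ => 0
  end.

Context (L : nil_algebra R) (b t : R).
Hypotheses (P_unit : P \in unitmx) (dP : structure_eqs L b t P).

Let braE := cof_bra dP.

Let levi_civita_cof k x X Y : (levi_civita L P x X Y)@_k =
  2^-1 * (metric P (bra L X Y) (frame P (ix k)) - metric P (bra L Y (frame P (ix k))) X
          + metric P (bra L (frame P (ix k)) X) Y).
Proof. exact: cof_sum. Qed.

(** Row k gives nabla_X Y along e^k: the coefficient of the coordinate j of Y is the
    connection form omega^k_j(X). *)
Lemma cof_levi_civita x X Y :
  ((levi_civita L P x X Y)@_1 = (t / 2) *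
     (2 * X@_6 * Y@_2 - (b + 1) * X@_5 * Y@_3 + (b - 1) * X@_6 * Y@_4
      - (b + 1) * X@_3 * Y@_5 + 2 * X@_2 * Y@_6 + (b - 1) * X@_4 * Y@_6)) *
  ((levi_civita L P x X Y)@_2 = (t / 2) *
     (- (2 * X@_6 * Y@_1) - (b + 1) * X@_6 * Y@_3 - (b - 1) * X@_5 * Y@_4
      - (b - 1) * X@_4 * Y@_5 - 2 * X@_1 * Y@_6 - (b + 1) * X@_3 * Y@_6)) *
  ((levi_civita L P x X Y)@_3 = (t / 2) *
     ((b + 1) * X@_5 * Y@_1 + (b + 1) * X@_6 * Y@_2 - 2 * X@_6 * Y@_4
      + (b + 1) * X@_1 * Y@_5 + (b + 1) * X@_2 * Y@_6 - 2 * X@_4 * Y@_6)) *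
  ((levi_civita L P x X Y)@_4 = (t / 2) *
     (- ((b - 1) * X@_6 * Y@_1) + (b - 1) * X@_5 * Y@_2 + 2 * X@_6 * Y@_3
      + (b - 1) * X@_2 * Y@_5 - (b - 1) * X@_1 * Y@_6 + 2 * X@_3 * Y@_6)) *
  ((levi_civita L P x X Y)@_5 = (t / 2) *
     ((b + 1) * X@_3 * Y@_1 + (b - 1) * X@_4 * Y@_2 - (b + 1) * X@_1 * Y@_3
      - (b - 1) * X@_2 * Y@_4)) *
  ((levi_civita L P x X Y)@_6 = (t / 2) *
     (- (2 * X@_2 * Y@_1) - (b - 1) * X@_4 * Y@_1 + 2 * X@_1 * Y@_2
      + (b + 1) * X@_3 * Y@_2 - (b + 1) * X@_2 * Y@_3 + 2 * X@_4 * Y@_3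
      + (b - 1) * X@_1 * Y@_4 - 2 * X@_3 * Y@_4)).
Proof.
by split; [split; [split; [split; [split|]|]|]|];
  rewrite levi_civita_cof !metricE !braE /ee !(cof_frame_ix P_unit) //=; field.
Qed.

Lemma cof_bismut x X Y :
  ((bismut L P x X Y)@_1 = t *
     (2 * X@_6 * Y@_2 - b * X@_5 * Y@_3 + b * X@_6 * Y@_4 - X@_3 * Y@_5 -
       X@_4 * Y@_6)) *
  ((bismut L P x X Y)@_2 = t *
     (- (2 * X@_6 * Y@_1) - b * X@_6 * Y@_3 - b * X@_5 * Y@_4 + X@_4 * Y@_5
      - X@_3 * Y@_6)) *
  ((bismut L P x X Y)@_3 = t *
     (b * X@_5 * Y@_1 + b * X@_6 * Y@_2 -
       2 * X@_6 * Y@_4 + X@_1 * Y@_5 + X@_2 * Y@_6)) *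
  ((bismut L P x X Y)@_4 = t *
     (- (b * X@_6 * Y@_1) + b * X@_5 * Y@_2 + 2 * X@_6 * Y@_3 - X@_2 * Y@_5
      + X@_1 * Y@_6)) *
  ((bismut L P x X Y)@_5 = t *
     (X@_3 * Y@_1 - X@_4 * Y@_2 - X@_1 * Y@_3 + X@_2 * Y@_4)) *
  ((bismut L P x X Y)@_6 = t *
     (X@_4 * Y@_1 + X@_3 * Y@_2 - X@_2 * Y@_3 - X@_1 * Y@_4)).
Proof.
by split; [split; [split; [split; [split|]|]|]|];
  rewrite /bismut cofD levi_civita_cof cof_sum // (torsionE P_unit dP) !metricE !braE;
  rewrite /torsion3 /ee /= !(cof_frame_ix P_unit) //=; field.
Qed.

End Curvature.

Lemma bismut_inv (R : realType) (L : nil_algebra R) (P : 'M[R]_6) y X Y :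
  bismut L P y X Y = bismut L P 0 X Y.
Proof.
(* The point only enters as the place where constant functions are
   differentiated, so that both sides are convertible. *)
by [].
Qed.

Section CurvatureForms.
Context (R : realType) (P : 'M[R]_6) (L : nil_algebra R) (b t : R).
Hypotheses (P_unit : P \in unitmx) (dP : structure_eqs L b t P).

Lemma curv_levi_civita (i j : 'I_6) x v : (i < j)%N ->
  curv_form L P (levi_civita L P) i j x v =
  levi_civita_curv P b t i.+1 j.+1 (v o0) (v o1).
Proof.
move=> ij; rewrite /curv_form metric_frame // (_ : ord_max = o1); last exact: val_inj.
have -> : frame P j = frame P (ix j.+1) by rewrite /ix inord_val.
rewrite curv_inv //.
(* Abstracting the connection prevents its definition from being unfolded. *)
move: (v o0) (v o1) => X Y.
move: (levi_civita L P 0) (cof_levi_civita P_unit dP 0) => nab nabE.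
by case: i ij => [[|[|[|[|[|[|i]]]]]] i6] // ij;
  case: j ij => [[|[|[|[|[|[|j]]]]]] j6] // _;
  rewrite !cofB !nabE !(cof_frame_ix P_unit) // !(cof_bra dP) /levi_civita_curv /ee /=; field.
Qed.

Lemma curv_bismut (i j : 'I_6) x v : (i < j)%N ->
  curv_form L P (bismut L P) i j x v = bismut_curv P b t i.+1 j.+1 (v o0) (v o1).
Proof.
move=> ij; rewrite /curv_form metric_frame // (_ : ord_max = o1); last exact: val_inj.
have -> : frame P j = frame P (ix j.+1) by rewrite /ix inord_val.
rewrite (curv_inv _ _ _ _ _ (bismut_inv L P)).
move: (v o0) (v o1) => X Y.
move: (bismut L P 0) (cof_bismut P_unit dP 0) => nab nabE.
by case: i ij => [[|[|[|[|[|[|i]]]]]] i6] // ij;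
  case: j ij => [[|[|[|[|[|[|j]]]]]] j6] // _;
  rewrite !cofB !nabE !(cof_frame_ix P_unit) // !(cof_bra dP) /bismut_curv /ee /=; ring.
Qed.

Lemma levi_civita_curvC i j X Y :
  levi_civita_curv P b t i j X Y = - levi_civita_curv P b t i j Y X.
Proof.
by do 7?[case: i => [|i]]; do 7?[case: j => [|j]]; rewrite /levi_civita_curv /ee /=; ring.
Qed.

Lemma bismut_curvC i j X Y :
  bismut_curv P b t i j X Y = - bismut_curv P b t i j Y X.
Proof.
by do 7?[case: i => [|i]]; do 7?[case: j => [|j]]; rewrite /bismut_curv /ee /=; ring.
Qed.

Lemma pontrjagin_levi_civita x v :
  pontrjagin L P (levi_civita L P) x v = - (8 * pi ^+ 2)^-1 *
    (2 * t ^+ 4 * (b ^+ 4 + 4 * b ^+ 2 + 11)) * ee4 P 1 2 3 4 (v o0) (v o1) (v o2) (v o3).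
Proof.
rewrite (pontrjaginE (Om := levi_civita_curv P b t)).
- rewrite -mulrA mulNr -mulrN; congr (_ * _).
  under eq_bigr do rewrite big_mkcond.
  rewrite !(big_ord_recl, big_ord0) /= /bump /= !add1n.
  by rewrite /pf /ee4 /levi_civita_curv /ee; field.
- exact: curv_levi_civita.
- exact: levi_civita_curvC.
Qed.

Lemma pontrjagin_bismut x v :
  pontrjagin L P (bismut L P) x v = - (8 * pi ^+ 2)^-1 *
    (8 * t ^+ 4 * (b ^+ 4 + 5 * b ^+ 2 + 10)) * ee4 P 1 2 3 4 (v o0) (v o1) (v o2) (v o3).
Proof.
rewrite (pontrjaginE (Om := bismut_curv P b t)).
- rewrite -mulrA mulNr -mulrN; congr (_ * _).
  under eq_bigr do rewrite big_mkcond.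
  rewrite !(big_ord_recl, big_ord0) /= /bump /= !add1n.
  by rewrite /pf /ee4 /bismut_curv /ee; ring.
- exact: curv_bismut.
- exact: bismut_curvC.
Qed.

(** The trace of J R^+(X, Y) is - 2 (Omega_12 + Omega_34 + Omega_56) because [J] is
    parallel, and the three curvature forms add up to zero. *)
Lemma hol_su3_bismut : hol_su3 L P (bismut L P).
Proof.
move=> x X Y.
have frE (i : 'I_6) : frame P i = frame P (ix i.+1) by rewrite /ix inord_val.
under eq_bigr => i _ do
  rewrite metric_frame // (curv_inv _ _ _ _ _ (bismut_inv L P)) frE.
move: (bismut L P 0) (cof_bismut P_unit dP 0) => nab nabE.
have nabJ W Z : nab W (Jop P Z) = Jop P (nab W Z).
  apply: (cof_inj P_unit) => -[[|[|[|[|[|[|k]]]]]] k6] //=;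
  by rewrite !nabE !(cof_J P_unit) ?nabE; ring.
pose rc i j := cof P i (nab X (nab Y (frame P (ix j))) - nab Y (nab X (frame P (ix j)))
  - nab (bra L X Y) (frame P (ix j))).
pose om i j := bismut_curv P b t i j X Y.
have rcE : [/\ rc 1%N 2%N = om 1%N 2%N, rc 3%N 4%N = om 3%N 4%N & rc 5%N 6%N = om 5%N 6%N].
  by split; rewrite /rc !cofB !nabE !(cof_frame_ix P_unit) // !(cof_bra dP);
    rewrite /om /bismut_curv /= /ee; ring.
have rcNE : [/\ rc 2%N 1%N = - om 1%N 2%N, rc 4%N 3%N = - om 3%N 4%N
    & rc 6%N 5%N = - om 5%N 6%N].
  by split; rewrite /rc !cofB !nabE !(cof_frame_ix P_unit) // !(cof_bra dP);
    rewrite /om /bismut_curv /= /ee; ring.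
transitivity (rc 2%N 1%N - rc 1%N 2%N + (rc 4%N 3%N - rc 3%N 4%N)
    + (rc 6%N 5%N - rc 5%N 6%N)).
  rewrite !(big_ord_recl, big_ord0) /= /bump /= !add1n !nabJ !cofB !(cof_J P_unit).
  by rewrite /rc !cofB; ring.
have [-> -> ->] := rcE; have [-> -> ->] := rcNE.
by rewrite /om /bismut_curv /ee; ring.
Qed.

End CurvatureForms.

(** * The balanced condition *)

Section Balanced.
Context (R : realType) (P : 'M[R]_6).

Lemma det_alt n (A : 'M[R]_n) : \det A = alt (fun w => \prod_i A i (w i)) id.
Proof. by []. Qed.

Lemma det_mx44 (A : 'M[R]_4) (m := fun i j k l => A i k * A j l - A i l * A j k) :
  \det A = m o0 o1 o0 o1 * m o2 o3 o2 o3 - m o0 o2 o0 o1 * m o1 o3 o2 o3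
    + m o0 o3 o0 o1 * m o1 o2 o2 o3 + m o1 o2 o0 o1 * m o0 o3 o2 o3
    - m o1 o3 o0 o1 * m o0 o2 o2 o3 + m o2 o3 o0 o1 * m o0 o1 o2 o3.
Proof.
rewrite det_alt (_ : (fun w => _) =
    fun w => A o0 (w o0) * (A o1 (w o1) * (A o2 (w o2) * A o3 (w o3)))).
  by rewrite (alt4 (fun i j k l => A o0 i * (A o1 j * (A o2 k * A o3 l)))) /m; ring.
by apply/funext => w; rewrite !(big_ord_recl, big_ord0) mulr1.
Qed.

Lemma det_delta_row0 n (A : 'M[R]_n.+1) j0 :
  (forall j, A ord0 j = (j0 == j)%:R) ->
  \det A = (-1) ^+ j0 * \det (row' ord0 (col' j0 A)).
Proof.
move=> A0; rewrite (expand_det_row A ord0) (bigD1 j0) //= big1 ?addr0 => [|j jNj0].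
  by rewrite A0 eqxx mul1r /cofactor.
by rewrite A0 eq_sym (negPf jNj0) mul0r.
Qed.

Lemma sum_ffun2 (K : zmodType) n (F : {ffun 'I_2 -> 'I_n} -> K) :
  \sum_I F I = \sum_i \sum_j F [ffun a => if a == o0 then i else j].
Proof.
rewrite pair_big (reindex (fun p : 'I_n * 'I_n =>
  [ffun a : 'I_2 => if a == o0 then p.1 else p.2])) //=.
apply/onW_bij; exists (fun I : {ffun 'I_2 -> 'I_n} => (I o0, I o1)) => [[i j]|I].
  by rewrite !ffunE.
by apply/ffunP => -[[|[|a]] a2] //; rewrite ffunE; congr (I _); apply: val_inj.
Qed.

Hypothesis P_unit : P \in unitmx.

(** The Hodge dual of the Kaehler form F is F^2 / 2.  In the sum defining it only the
    six ordered pairs of frame vectors spanning a complex line survive, and each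
    leaves the volume form contracted with that line, a minor of size 4. *)
Lemma hodge_kahlerE x v :
  @hodge R P 2 4 (vol P) (kahler P) x v = ee4 P 3 4 5 6 (v o0) (v o1) (v o2) (v o3)
   + ee4 P 1 2 5 6 (v o0) (v o1) (v o2) (v o3) + ee4 P 1 2 3 4 (v o0) (v o1) (v o2) (v o3).
Proof.
rewrite /hodge sum_ffun2.
pose d i j := \det (\matrix_(k < 6, l < 6)
  cof P l.+1 (fcons (frame P i) (fcons (frame P j) v) k)).
have volE i j (I := [ffun a : 'I_2 => if a == o0 then i else j]) :
    vol P x (fun k => match @fintype.split 2 4 k with
    | inl a => frame P (I a)
    | inr c => v c end) = d i j.
  rewrite /vol /d; congr (\det _); apply/matrixP => k l.
  rewrite mxE [RHS]mxE cof_ord; congr ((_ *m _) _ _).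
  rewrite (_ : fcons _ _ k = match @fintype.split 2 4 k with
    | inl a => frame P (I a) | inr c => v c end) //.
  case: (@fintype.splitP 2 4 k) => [a|c] kE.
    have -> : k = if a == o0 then o0 else o1.
      by apply: val_inj; rewrite /= kE; case: a {kE} => [[|[|]]].
    by rewrite /I ffunE; case: eqP => _; rewrite ?fconsS fcons0.
  have -> : k = lift o0 (lift o0 c) by apply: val_inj; rewrite /= kE.
  by rewrite !fconsS.
have kE i j :
   kahler P x (fun a => frame P ([ffun a : 'I_2 => if a == o0 then i else j] a)) =
   ee P 1 2 (frame P i) (frame P j) + ee P 3 4 (frame P i) (frame P j)
   + ee P 5 6 (frame P i) (frame P j).
  by rewrite (kahlerE P_unit) !ffunE.
have dE i j j' : j = lift i j' -> d i j = (-1) ^+ i * (-1) ^+ j' *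
    \det (\matrix_(k < 4, l < 4) cof P (lift i (lift j' l)).+1 (v k)).
  move=> ->; rewrite /d (det_delta_row0 (j0 := i)) => [|l]; last first.
    by rewrite mxE fcons0 cof_frame // /ix inord_val.
  rewrite (det_delta_row0 (j0 := j')) => [|l]; last first.
    by rewrite !mxE fconsS fcons0 cof_frame // /ix inord_val (inj_eq lift_inj).
  rewrite mulrA; congr (_ * \det _); apply/matrixP => k l.
  by rewrite !mxE !fconsS.
(* the pairs (E_1, E_2), (E_3, E_4), (E_5, E_6) and their transposes *)
have dEs := (dE o0 o1 o0, dE o1 o0 o0, dE o2 o3 o2, dE o3 o2 o2, dE o4 o5 o4, dE o5 o4 o4).
under eq_bigr do under eq_bigr do rewrite volE kE /ee !cof_frame //.
rewrite !(big_ord_recl, big_ord0) /ix -!val_eqE /= !inordK //= /bump /=.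
rewrite !(mul0r, mulr0, mul1r, mulr1, addr0, add0r, subr0, sub0r, oppr0) !mulN1r.
rewrite !dEs; do ?by apply: val_inj.
rewrite !det_mx44 !mxE /= /bump /= !(add0n, add1n) /ee4 /ee.
by rewrite (_ : 2`!%N = 2%N) //; field.
Qed.

Context (L : nil_algebra R) (b t : R).
Hypothesis (dP : structure_eqs L b t P).

Lemma adapted_balanced : balanced L P.
Proof.
move=> x v; rewrite (ext_d4 L (a := fun X Y Z W =>
   ee4 P 3 4 5 6 X Y Z W + ee4 P 1 2 5 6 X Y Z W + ee4 P 1 2 3 4 X Y Z W)).
  by rewrite /ee4 /ee !(cof_bra dP) /ee; ring.
exact: hodge_kahlerE.
Qed.

End Balanced.

(** * Abelian instantons *)

(** The anti-self-dual forms in e^1, ..., e^4, for the orientation e^1234. *)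
Definition asd (R : realType) (P : 'M[R]_6) (a c d : R) (X Y : vec R) : R :=
  a * (ee P 1 2 X Y - ee P 3 4 X Y) + c * (ee P 1 3 X Y + ee P 2 4 X Y)
  + d * (ee P 1 4 X Y - ee P 2 3 X Y).

Section Instanton.
Local Open Scope complex_scope.
Context (R : realType) (P : 'M[R]_6).

Lemma instanton_form (a r s : R) x v :
  let q : R[i] := (r +i* s) in let q' : R[i] := (r -i* s) in
  'i%C * a%:C * wedge (om1 P) (form_conj (om1 P)) x v
    - 'i%C * a%:C * wedge (om2 P) (form_conj (om2 P)) x v
    + q * wedge (om1 P) (form_conj (om2 P)) x v
    - q' * wedge (om2 P) (form_conj (om1 P)) x v
  = (asd P (2 * a) (2 * r) (2 * s) (v o0) (v o1))%:C.
Proof.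
have om11E := @wedge_om _ (om1 P) (form_conj (om1 P))
  (cof P 1) (cof P 2) (cof P 1) (fun X => - cof P 2 X).
have om1bE := @wedge_om _ (om1 P) (form_conj (om2 P))
  (cof P 1) (cof P 2) (cof P 3) (fun X => - cof P 4 X).
have om22E := @wedge_om _ (om2 P) (form_conj (om2 P))
  (cof P 3) (cof P 4) (cof P 3) (fun X => - cof P 4 X).
have om2bE := @wedge_om _ (om2 P) (form_conj (om1 P))
  (cof P 3) (cof P 4) (cof P 1) (fun X => - cof P 2 X).
rewrite /= om11E // om1bE // om22E // om2bE // /asd /ee.
by apply/eqP; rewrite eq_complex /=; apply/andP; split; apply/eqP; ring.
Qed.

Context (M : nilmanifold R) (A : u1_connection M).

(** The norm is constant because 4 f^2 + 4 (1/4 - f^2) = 1, the phase gamma only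
    rotating the last two coefficients. *)
Lemma instanton_curv : abelian_instanton P A -> forall x, exists a c d : R,
  a ^+ 2 + c ^+ 2 + d ^+ 2 = 1 /\
  forall v, u1_curv A x v = asd P a c d (v o0) (v o1).
Proof.
move=> [f [gam [f_le curvE _ _]]] x.
set z := z1 P x; set w := z2 P x; set r := Num.sqrt (4^-1 - f z w ^+ 2).
exists (2 * f z w), (2 * (r * cos (gam z w))), (2 * (r * sin (gam z w))).
split.
  have r2 : r ^+ 2 = 4^-1 - f z w ^+ 2.
    by rewrite sqr_sqrtr //; have := f_le z w; rewrite ler_norml => /andP[]; nra.
  have := cos2Dsin2 (gam z w); nra.
move=> v; have := curvE x v; rewrite /= -/z -/w.
rewrite (_ : expi (gam z w) * (Num.sqrt (4^-1 - f z w ^+ 2))%:C =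
  (r * cos (gam z w)) +i* (r * sin (gam z w))); last first.
  apply/eqP; rewrite eq_complex /= -/r.
  by apply/andP; split; apply/eqP; ring.
rewrite (_ : expi (- gam z w) * (Num.sqrt (4^-1 - f z w ^+ 2))%:C =
  (r * cos (gam z w)) -i* (r * sin (gam z w))); last first.
  apply/eqP; rewrite eq_complex /= cosN sinN -/r.
  by apply/andP; split; apply/eqP; ring.
by rewrite instanton_form => -[].
Qed.

Hypotheses (P_unit : P \in unitmx) (A_inst : abelian_instanton P A).

Lemma su3_instanton_u1 : su3_instanton P (u1_curv A).
Proof.
split=> [x X Y|x]; have [a [c [d [_ FE]]]] := instanton_curv A_inst x.
  by rewrite !FE /= /asd /ee !(cof_J P_unit); ring.
under eq_bigr do rewrite FE.
have frE (i : 'I_6) : frame P i = frame P (ix i.+1) by rewrite /ix inord_val.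
under eq_bigr => i _ do rewrite /asd /vec2 /ee !(cof_J P_unit) frE /=.
rewrite !(big_ord_recl, big_ord0) /= /bump /= !add1n !(cof_frame_ix P_unit) //=; ring.
Qed.

(** The square of an anti-self-dual form is minus its squared norm times e^1234. *)
Lemma u1_p1E x v : u1_p1 A x v =
  - (8 * pi ^+ 2)^-1 * 2 * ee4 P 1 2 3 4 (v o0) (v o1) (v o2) (v o3).
Proof.
have [a [c [d [acd FE]]]] := instanton_curv A_inst x.
rewrite /u1_p1 (wedge22 (a := asd P a c d) (b := asd P a c d)) //; first last.
- by move=> X Y; rewrite /asd /ee; ring.
- by move=> X Y; rewrite /asd /ee; ring.
rewrite -mulrA mulNr -mulrN; congr (_ * _).
rewrite -[X in - (2 * X)]mul1r -[X in - (2 * (X * _))]acd /asd /ee4 /ee; ring.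
Qed.

End Instanton.

(** * The heterotic system for a given instanton *)

Section Solution.
Context (R : realType) (b t : R) (M : nilmanifold R) (P : 'M[R]_6) (A : u1_connection M).
Hypotheses (t_neq0 : t != 0) (P_adapted : adapted_coframe M b t P)
  (A_inst : abelian_instanton P A).

Let P_unit : P \in unitmx. Proof. by case: P_adapted. Qed.
Let dP : structure_eqs M b t P.
Proof. by have [] := (adapted_coframeP M P b t_neq0).1 P_adapted. Qed.

Let pi_neq0 : pi != 0 :> R. Proof. by rewrite gt_eqF // pi_gt0. Qed.

Lemma anomaly_levi_civita : t ^+ 4 * (b ^+ 4 + 4 * b ^+ 2 + 11) - 1 != 0 ->
  anomaly P A (levi_civita M P) (16 * pi ^+ 2 * t ^+ 2 * (b ^+ 2 + 3)
         / (t ^+ 4 * (b ^+ 4 + 4 * b ^+ 2 + 11) - 1)).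
Proof.
move=> D0 x v; rewrite (ext_d_torsion P_unit dP) (u1_p1E A_inst).
rewrite (pontrjagin_levi_civita P_unit dP).
by move: (pi : R) pi_neq0 => p p_neq0; field; rewrite D0 p_neq0.
Qed.

Lemma anomaly_bismut : 4 * t ^+ 4 * (b ^+ 4 + 5 * b ^+ 2 + 10) - 1 != 0 ->
  anomaly P A (bismut M P) (16 * pi ^+ 2 * t ^+ 2 * (b ^+ 2 + 3)
         / (4 * t ^+ 4 * (b ^+ 4 + 5 * b ^+ 2 + 10) - 1)).
Proof.
move=> D0 x v; rewrite (ext_d_torsion P_unit dP) (u1_p1E A_inst).
rewrite (pontrjagin_bismut P_unit dP).
by move: (pi : R) pi_neq0 => p p_neq0; field; rewrite D0 p_neq0.
Qed.

Lemma torsion_neq0 : exists x v, torsion M P x v != 0.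
Proof.
exists 0, (fun i : 'I_3 => frame P (ix (nth 0%N [:: 1; 2; 6] i))).
rewrite (torsionE P_unit dP) /torsion3 /ee /= !(cof_frame_ix P_unit) //=.
rewrite (_ : t * _ = - 2 * t); last by ring.
by rewrite mulf_neq0 // oppr_eq0 pnatr_eq0.
Qed.

Lemma adapted_heterotic_solution : 4^-1 < t ^+ 4 * (b ^+ 4 + 5 * b ^+ 2 + 10) ->
  1 < t ^+ 4 * (b ^+ 4 + 4 * b ^+ 2 + 11) -> heterotic_solution P A.
Proof.
move=> Dp D; have num_gt0 : 0 < t ^+ 2 * (b ^+ 2 + 3).
  by rewrite mulr_gt0 ?exprn_even_gt0 //; have := sqr_ge0 b; lra.
have Dp0 : 0 < 4 * t ^+ 4 * (b ^+ 4 + 5 * b ^+ 2 + 10) - 1 by move: Dp; lra.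
have D0 : 0 < t ^+ 4 * (b ^+ 4 + 4 * b ^+ 2 + 11) - 1 by rewrite subr_gt0.
split; first split.
- exact: hol_su3_bismut dP.
- exact: adapted_balanced dP.
- exact: su3_instanton_u1.
- exact: torsion_neq0.
(* alpha' is the coefficient of the anomaly divided by 2 pi^2. *)
- exists (8 * (t ^+ 2 * (b ^+ 2 + 3)) / (t ^+ 4 * (b ^+ 4 + 4 * b ^+ 2 + 11) - 1)).
    by rewrite divr_gt0 // mulr_gt0.
  move: (anomaly_levi_civita (lt0r_neq0 D0)).
  by congr anomaly; field; rewrite lt0r_neq0.
- exists (8 * (t ^+ 2 * (b ^+ 2 + 3)) / (4 * t ^+ 4 * (b ^+ 4 + 5 * b ^+ 2 + 10) - 1)).
    by rewrite divr_gt0 // mulr_gt0.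
  move: (anomaly_bismut (lt0r_neq0 Dp0)).
  by congr anomaly; field; rewrite lt0r_neq0.
Qed.

End Solution.

Lemma admissible_t (R : realType) (b : R) : exists t : R, [/\ t != 0,
  4^-1 < t ^+ 4 * (b ^+ 4 + 5 * b ^+ 2 + 10) & 1 < t ^+ 4 * (b ^+ 4 + 4 * b ^+ 2 + 11)].
Proof.
have b2 := sqr_ge0 b; have b4 : 0 <= b ^+ 4 by rewrite exprn_even_ge0.
by exists 1; rewrite expr1n oner_eq0; split => //; lra.
Qed.

(** * A common normal form of the three Lie algebras *)

Section Coframes.
Context (R : realType).

Lemma unit_coframe (U : 'M[R]_6) :
  (forall X, (forall i : 'I_6, cof U i.+1 X = 0) -> X = 0) -> U \in unitmx.
Proof.
move=> injU; rewrite -row_free_unit -kermx_eq0; apply/eqP/row_matrixP => i.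
rewrite row0; apply: injU => j; rewrite cof_ord -row_mul mulmx_ker.
by rewrite row0 mxE.
Qed.

Lemma coframe_of (phi : nat -> vec R -> R) :
  (forall k a X Y, phi k (a *: X + Y) = a * phi k X + phi k Y) ->
  (forall X, phi 1%N X = 0 -> phi 2%N X = 0 -> phi 3%N X = 0 -> phi 4%N X = 0 ->
     phi 5%N X = 0 -> phi 6%N X = 0 -> X = 0) ->
  exists2 U : 'M[R]_6, U \in unitmx & forall k X, (0 < k < 7)%N -> cof U k X = phi k X.
Proof.
move=> lin ker0; pose U : 'M[R]_6 := \matrix_(i, j) phi j.+1 (delta_mx ord0 i).
have UE k X : (0 < k < 7)%N -> cof U k X = phi k X.
  move=> /andP[k0 k7]; have phi0 : phi k 0 = 0.
    by have := lin k (-1) 0 0; rewrite scaler0 addr0 mulN1r addNr.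
  rewrite /cof mxE [in RHS](row_sum_delta X).
  elim/big_rec2: _ => [|i y1 y2 _ IH]; first by rewrite phi0.
  by rewrite lin IH !mxE /ix inordK ?prednK.
exists U => //; apply: unit_coframe => X X0.
by apply: ker0; rewrite -UE //; [exact: (X0 o0)|exact: (X0 o1)|exact: (X0 o2)|
  exact: (X0 o3)|exact: (X0 o4)|exact: (X0 o5)].
Qed.

(** Over the algebra A = R[tau] / (tau^2 = s), the A-valued functions
    u^2 + tau u^1 and u^4 + tau u^3 have the product du^5 + tau du^6. *)
Definition normal_form (L : nil_algebra R) (s : R) (U : 'M[R]_6) :=
  U \in unitmx /\ forall X Y, [/\
    [/\ cof U 1 (bra L X Y) = 0, cof U 2 (bra L X Y) = 0,
      cof U 3 (bra L X Y) = 0 & cof U 4 (bra L X Y) = 0],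
    cof U 5 (bra L X Y) = - (s * ee U 1 3 X Y + ee U 2 4 X Y) &
    cof U 6 (bra L X Y) = - (ee U 1 4 X Y + ee U 2 3 X Y)].

Lemma e2fE (P : 'M[R]_6) i j x v : e2f P i j x v = ee P i j (v o0) (v o1).
Proof. by rewrite /e2f (wedge11 (a := cof P i) (b := cof P j)) // /ee; ring. Qed.

Lemma cof_sep (P : 'M[R]_6) X : P \in unitmx ->
  cof P 1 X = 0 -> cof P 2 X = 0 -> cof P 3 X = 0 -> cof P 4 X = 0 ->
  cof P 5 X = 0 -> cof P 6 X = 0 -> X = 0.
Proof.
move=> P_unit X1 X2 X3 X4 X5 X6; apply: (cof_inj P_unit).
by case=> [[|[|[|[|[|[|k]]]]]] k6] //; rewrite cof0.
Qed.

Context (L : nil_algebra R).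

Lemma closed_cofE (P : 'M[R]_6) X Y : closed_cof L P ->
  (cof P 1 (bra L X Y) = 0) * (cof P 2 (bra L X Y) = 0) *
  (cof P 3 (bra L X Y) = 0) * (cof P 4 (bra L X Y) = 0) :> Type.
Proof.
move=> clP; have dE k : (0 < k < 5)%N -> cof P k (bra L X Y) = 0.
  by move/clP/(_ 0 (vec2 X Y))/eqP; rewrite ext_d_e1f oppr_eq0 => /eqP.
by rewrite !dE.
Qed.

Lemma cof_bra_d (P : 'M[R]_6) k F X Y :
  (forall x v, ext_d L (e1f P k) x v = F x v) ->
  cof P k (bra L X Y) = - F 0 (vec2 X Y).
Proof. by move=> <-; rewrite ext_d_e1f opprK. Qed.

(** Here A is R * R, and e^1, e^2, resp. e^3, e^4, are coordinates on the two
    factors of A^2. *)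
Lemma h2_normal_form : is_h2 L -> exists U, normal_form L 1 U.
Proof.
move=> [Q [Q_unit clQ d5 d6]].
pose phi k X : R := match k with
  | 1 => cof Q 1 X + cof Q 3 X | 2 => cof Q 1 X - cof Q 3 X
  | 3 => cof Q 2 X + cof Q 4 X | 4 => cof Q 2 X - cof Q 4 X
  | 5 => 2 * (cof Q 5 X + cof Q 6 X) | _ => 2 * (cof Q 5 X - cof Q 6 X) end.
have [k a X Y|X|U U_unit UE] := coframe_of (phi := phi).
- by case: k => [|[|[|[|[|[|k]]]]]]; rewrite /phi !cofDZ; ring.
- by rewrite /phi /= => *; apply: (cof_sep Q_unit); lra.
exists U; split=> // X Y.
rewrite /ee !UE //= !(closed_cofE _ _ clQ) (cof_bra_d _ _ d5) (cof_bra_d _ _ d6).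
by rewrite !e2fE /vec2 /= /ee; split; [split|..]; ring.
Qed.

(** Here A is the algebra of dual numbers. *)
Lemma h4_normal_form : is_h4 L -> exists U, normal_form L 0 U.
Proof.
move=> [Q [Q_unit clQ d5 d6]].
pose phi k X : R := match k with
  | 1 => cof Q 3 X | 2 => cof Q 1 X | 3 => cof Q 4 X | 4 => - cof Q 2 X
  | 5 => - cof Q 5 X | _ => cof Q 6 X end.
have [k a X Y|X|U U_unit UE] := coframe_of (phi := phi).
- by case: k => [|[|[|[|[|[|k]]]]]]; rewrite /phi !cofDZ; ring.
- by rewrite /phi /= => *; apply: (cof_sep Q_unit); lra.
exists U; split=> // X Y.
rewrite /ee !UE //= !(closed_cofE _ _ clQ) (cof_bra_d _ _ d5) (cof_bra_d _ _ d6).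
by rewrite !e2fE /vec2 /= /ee; split; [split|..]; ring.
Qed.

(** Here A is the field of complex numbers. *)
Lemma h5_normal_form : is_h5 L -> exists U, normal_form L (-1) U.
Proof.
move=> [Q [Q_unit clQ d5 d6]].
pose phi k X : R := match k with
  | 1 => cof Q 1 X | 2 => cof Q 2 X | 3 => cof Q 3 X | 4 => cof Q 4 X
  | 5 => - cof Q 5 X | _ => cof Q 6 X end.
have [k a X Y|X|U U_unit UE] := coframe_of (phi := phi).
- by case: k => [|[|[|[|[|[|k]]]]]]; rewrite /phi !cofDZ; ring.
- by rewrite /phi /= => *; apply: (cof_sep Q_unit); lra.
exists U; split=> // X Y.
rewrite /ee !UE //= !(closed_cofE _ _ clQ) (cof_bra_d _ _ d5) (cof_bra_d _ _ d6).
by rewrite !e2fE /vec2 /= /ee; split; [split|..]; ring.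
Qed.

(** If x and y are the coordinates of two functionals xi and eta on R^4, then
    pencilA + tau pencilB is the determinant of the A-linear maps with
    tau-components xi and eta. *)
Definition pencilA (s : R) (x y : 'I_4 -> R) : R :=
  (x o0 * y o2 - x o2 * y o0) + s * (x o1 * y o3 - x o3 * y o1).
Definition pencilB (x y : 'I_4 -> R) : R :=
  (x o0 * y o3 - x o3 * y o0) + (x o1 * y o2 - x o2 * y o1).

Definition lin4 (U : 'M[R]_6) (x : 'I_4 -> R) X : R := \sum_(i < 4) cof U i.+1 X * x i.

Lemma lin4E U x X : lin4 U x X =
  cof U 1 X * x o0 + cof U 2 X * x o1 + cof U 3 X * x o2 + cof U 4 X * x o3.
Proof. by rewrite /lin4 !(big_ord_recl, big_ord0) /= addr0 !addrA. Qed.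

(** The multiplication by tau acts on functionals by the operator T below, and the new
    coframe is xi, T xi, eta, T eta.  Its products span the same pencil of 2-forms,
    the change of basis having as determinant the norm A^2 - s B^2 of the
    determinant over the algebra. *)
Lemma adjusted_normal_form (s : R) (U : 'M[R]_6) (x y : 'I_4 -> R) :
  normal_form L s U -> pencilA s x y ^+ 2 - s * pencilB x y ^+ 2 != 0 ->
  exists2 U', normal_form L s U' &
    forall X, cof U' 1 X = lin4 U x X /\ cof U' 3 X = lin4 U y X.
Proof.
move=> [U_unit dU]; set A := pencilA s x y; set B := pencilB x y => D0.
pose T (x : 'I_4 -> R) (i : 'I_4) :=
  nth 0 [:: s * x o1; x o0; s * x o3; x o2] (nat_of_ord i).
have TE z X : lin4 U (T z) X = cof U 1 X * (s * z o1) + cof U 2 X * z o0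
    + cof U 3 X * (s * z o3) + cof U 4 X * z o2 by rewrite lin4E.
pose phi k X : R := match k with
  | 1 => lin4 U x X | 2 => lin4 U (T x) X | 3 => lin4 U y X | 4 => lin4 U (T y) X
  | 5 => A * cof U 5 X + s * B * cof U 6 X | _ => A * cof U 6 X + B * cof U 5 X end.
have pencil X Y :
    s * (lin4 U x X * lin4 U y Y - lin4 U y X * lin4 U x Y)
      + (lin4 U (T x) X * lin4 U (T y) Y - lin4 U (T y) X * lin4 U (T x) Y)
    = A * (s * ee U 1 3 X Y + ee U 2 4 X Y) + s * B * (ee U 1 4 X Y + ee U 2 3 X Y) /\
    (lin4 U x X * lin4 U (T y) Y - lin4 U (T y) X * lin4 U x Y)
      + (lin4 U (T x) X * lin4 U y Y - lin4 U y X * lin4 U (T x) Y)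
    = A * (ee U 1 4 X Y + ee U 2 3 X Y) + B * (s * ee U 1 3 X Y + ee U 2 4 X Y).
  by rewrite !TE !lin4E /ee /A /B /pencilA /pencilB; split; ring.
have solve u v : A * u + s * B * v = 0 -> A * v + B * u = 0 -> u = 0 /\ v = 0.
  move=> e1 e2; split; apply: (mulfI D0); rewrite mulr0.
    by transitivity (A * (A * u + s * B * v) - s * B * (A * v + B * u));
      [ring|rewrite e1 e2; ring].
  by transitivity (A * (A * v + B * u) - B * (A * u + s * B * v));
    [ring|rewrite e1 e2; ring].
have [k a X Y|X|U' U'_unit UE] := coframe_of (phi := phi).
- by case: k => [|[|[|[|[|[|k]]]]]]; rewrite /phi ?TE ?lin4E !cofDZ; ring.
- rewrite /phi /= => X1 X2 X3 X4 X5 X6; have [X5' X6'] := solve _ _ X5 X6.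
  (* A vector killed by the four new functionals lies in the radical of the
     pencil, which is trivial. *)
  have nil Y : s * ee U 1 3 X Y + ee U 2 4 X Y = 0 /\ ee U 1 4 X Y + ee U 2 3 X Y = 0.
    by have [p5 p6] := pencil X Y; apply: solve; [rewrite -p5|rewrite -p6];
      rewrite X1 X2 X3 X4; ring.
  apply: (cof_sep U_unit) => //.
  + by have [_] := nil (frame U (ix 4)); rewrite /ee !(cof_frame_ix U_unit) //=; lra.
  + by have [_] := nil (frame U (ix 3)); rewrite /ee !(cof_frame_ix U_unit) //=; lra.
  + by have [_] := nil (frame U (ix 2)); rewrite /ee !(cof_frame_ix U_unit) //=; lra.
  + by have [_] := nil (frame U (ix 1)); rewrite /ee !(cof_frame_ix U_unit) //=; lra.
exists U' => [|X]; last by rewrite !UE.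
split=> // X Y; have [[b1 b2 b3 b4] b5 b6] := dU X Y; have [p5 p6] := pencil X Y.
rewrite /ee !UE //= p5 p6 b5 b6 !TE !lin4E b1 b2 b3 b4.
by split; [split|..]; ring.
Qed.

(** With e^1 = u^1 and e^3 = u^3 the form de^6 of an adapted coframe is, up to a
    factor, u^1 /\ u^4 + u^2 /\ u^3 for u^2 = k ((b + 1) e^2 - 2 e^4) and
    u^4 = - k (2 e^2 + (b - 1) e^4).  Then u^24 = - k^2 (b^2 + 3) e^24, and de^5 is
    proportional to s u^13 + u^24 under the stated relation between s, k and b.  The
    witness inverts this change of coframe and rescales it by l. *)
Lemma normal_form_adapted (s k l b t : R) (U : 'M[R]_6) : normal_form L s U ->
  k != 0 -> l != 0 -> b != 1 -> t != 0 -> s * (1 - b) = k ^+ 2 * (b ^+ 2 + 3) * (1 + b) ->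
  exists P, [/\ P \in unitmx, structure_eqs L b t P &
    forall X, cof P 1 X = l * cof U 1 X /\ cof P 3 X = l * cof U 3 X].
Proof.
move=> [U_unit dU] k0 l0 b1 t0 skb; have c0 : b ^+ 2 + 3 != 0.
  by rewrite lt0r_neq0 //; have := sqr_ge0 b; lra.
have b10 : 1 - b != 0 by rewrite subr_eq0 eq_sym.
set c := b ^+ 2 + 3 in c0 skb.
pose phi i X : R := match i with
  | 1 => l * cof U 1 X
  | 2 => l * ((b - 1) * cof U 2 X - 2 * cof U 4 X) / (k * c)
  | 3 => l * cof U 3 X
  | 4 => - l * (2 * cof U 2 X + (b + 1) * cof U 4 X) / (k * c)
  | 5 => l ^+ 2 * t * (1 - b) / (k ^+ 2 * c) * cof U 5 X
  | _ => l ^+ 2 * t / k * cof U 6 X end.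
have kc0 : k * c != 0 by rewrite mulf_neq0.
have c5 : l ^+ 2 * t * (1 - b) / (k ^+ 2 * c) != 0.
  by rewrite !(mulf_neq0, invr_neq0, expf_neq0).
have c6 : l ^+ 2 * t / k != 0 by rewrite !(mulf_neq0, invr_neq0, expf_neq0).
have [i a X Y|X|P P_unit PE] := coframe_of (phi := phi).
- by case: i => [|[|[|[|[|[|i]]]]]]; rewrite /phi !cofDZ; ring.
- rewrite /phi /= => X1 X2 X3 X4 X5 X6.
  have [U1 U3] : cof U 1 X = 0 /\ cof U 3 X = 0.
    by split; apply: (mulfI l0); rewrite mulr0.
  have [e2 e4] : (b - 1) * cof U 2 X - 2 * cof U 4 X = 0 /\
      2 * cof U 2 X + (b + 1) * cof U 4 X = 0.
    split; apply: (mulfI l0); apply: (mulIf (invr_neq0 kc0)); rewrite mulr0 mul0r //.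
    by move: X4; rewrite !mulNr => /eqP; rewrite oppr_eq0 => /eqP.
  apply: (cof_sep U_unit) => //.
  + apply: (mulfI c0); rewrite mulr0 /c.
    by transitivity ((b + 1) * ((b - 1) * cof U 2 X - 2 * cof U 4 X)
      + 2 * (2 * cof U 2 X + (b + 1) * cof U 4 X)); [ring|rewrite e2 e4; ring].
  + apply: (mulfI c0); rewrite mulr0 /c.
    by transitivity ((b - 1) * (2 * cof U 2 X + (b + 1) * cof U 4 X)
      - 2 * ((b - 1) * cof U 2 X - 2 * cof U 4 X)); [ring|rewrite e2 e4; ring].
  + by apply: (mulfI c5); rewrite X5 mulr0.
  + by apply: (mulfI c6); rewrite X6 mulr0.
exists P; split=> // [X Y|X]; last by rewrite !PE.
have [[u1 u2 u3 u4] u5 u6] := dU X Y.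
rewrite /ee !PE //= u1 u2 u3 u4 u5 u6 /ee.
have -> : s = k ^+ 2 * c * (1 + b) / (1 - b) by rewrite -skb mulfK.
by split; [split|..]; rewrite /c; field; rewrite -?/c ?k0 ?b10 ?c0.
Qed.

End Coframes.

(** * A constant instanton on a suitable quotient *)

Section AffineFunctions.
Context (R : realType).

Definition affine (f : vec R -> R) :=
  exists c (w : 'cV[R]_6), forall x, f x = c + (x *m w) ord0 ord0.

Lemma derive_affine (f : vec R -> R^o) c (w : 'cV[R]_6) :
  (forall x, f x = c + (x *m w) ord0 ord0) -> forall X x, 'D_X f x = (X *m w) ord0 ord0.
Proof.
move=> fE X x; apply: cvg_lim => //; apply: cvg_near_cst.
near=> h; rewrite /= !fE mulmxDl -scalemxAl !mxE.
have h0 : h != 0 by near: h; exact: nbhs_dnbhs_neq.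
by rewrite /GRing.scale /= [X in _ * X](_ : _ = h * \sum_j X ord0 j * w j ord0);
  [rewrite mulKf|ring].
Unshelve. all: by end_near. Qed.

Lemma affine_smooth (f : vec R -> R) : affine f -> smooth f.
Proof.
move=> f_aff s x; suff [c [w fE]] : affine (foldr (fun X (h : vec R -> R^o) => 'D_X h) f s).
  rewrite (_ : foldr _ _ _ =
      (fun x : vec R => cst c x + \sum_(i < 6) w i ord0 *: (x ord0 i : R^o))).
    apply: differentiableD; first exact: differentiable_cst.
    rewrite (_ : (fun _ => _) =
        \sum_(i < 6) (fun x : vec R => w i ord0 *: (x ord0 i : R^o))).
      by apply: differentiable_sum => i; apply/differentiableZ/differentiable_coord.
    by apply/funext => y; rewrite fct_sumE.
  apply/funext => y; rewrite fE mxE; congr (_ + _); apply: eq_bigr => i _.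
  by rewrite mulrC.
elim: s => //= X s [c [w fE]]; exists ((X *m w) ord0 ord0), 0 => y.
by rewrite (derive_affine fE) mulmx0 [X in _ + X]mxE addr0.
Qed.

Lemma cof_col (P : 'M[R]_6) k x : cof P k x = (x *m col (ix k) P) ord0 ord0.
Proof. by rewrite /cof colE mulmxA -colE [RHS]mxE. Qed.

Lemma cof_affine (P : 'M[R]_6) k : affine (cof P k).
Proof. by exists 0, (col (ix k) P) => x; rewrite add0r cof_col. Qed.

Lemma affine_comb f g (a b c : R) : affine f -> affine g ->
  affine (fun x => a * f x + b * g x + c).
Proof.
move=> [d [u fE]] [e [v gE]]; exists (a * d + b * e + c), (a *: u + b *: v) => x.
by rewrite fE gE mulmxDr -!scalemxAr !mxE; ring.
Qed.

Lemma derive_comb (P : 'M[R]_6) k l (a b c : R) X x :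
  'D_X (fun x => a * cof P k x + b * cof P l x + c : R^o) x = a * cof P k X + b * cof P l X.
Proof.
have wE y : (y *m (a *: col (ix k) P + b *: col (ix l) P)) ord0 ord0
    = a * cof P k y + b * cof P l y.
  by rewrite mulmxDr -!scalemxAr mxE [X in X + _]mxE [X in _ + X]mxE !cof_col.
rewrite (@derive_affine _ c (a *: col (ix k) P + b *: col (ix l) P)) ?wE // => y.
by rewrite wE addrC.
Qed.

End AffineFunctions.

Section ConstantInstanton.
Context (R : realType) (M : nilmanifold R) (b t : R) (P : 'M[R]_6).
Hypotheses (t_neq0 : t != 0) (b_neq1 : b != 1) (dP : structure_eqs M b t P).

Let k := (1 - b)^-1.

(** The 1-form k (e^1(x) e^3 - e^3(x) e^1) is a primitive of 2 k e^13; a translation by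
    g changes it by the differential of this linear function. *)
Definition translation_phase (g x : vec R) : R :=
  k * (cof P 1 g * cof P 3 x - cof P 3 g * cof P 1 x).

Hypothesis quantized : forall g h, lattice M g -> lattice M h ->
  exists n : int, translation_phase g h = 2 * pi * n%:~R.

(* The second term is invariant; its differential, a multiple of de^5, turns
   2 k e^13 into e^13 + e^24. *)
Let potential : form R R 1 := fun x v =>
  translation_phase x (v ord0) - cof P 5 (v ord0) * (t * (1 - b))^-1.

Let phaseE g : translation_phase g =
  fun x => k * cof P 1 g * cof P 3 x + - k * cof P 3 g * cof P 1 x + 0.
Proof. by apply/funext => x; rewrite /translation_phase; ring. Qed.

Let potE v : (fun x => potential x v) = fun x => k * cof P 3 (v ord0) * cof P 1 x
  + - k * cof P 1 (v ord0) * cof P 3 x + - (cof P 5 (v ord0) * (t * (1 - b))^-1).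
Proof. by apply/funext => x; rewrite /potential /translation_phase; ring. Qed.

Let cof_gmul g x j : (j == 1%N) || (j == 3%N) ->
  cof P j (gmul M g x) = cof P j g + cof P j x.
Proof.
have [[b1 _ b3 _] _ _] := dP g x; rewrite /gmul !cofD cofZ.
by case/orP => /eqP ->; rewrite (b1, b3) mulr0 addr0.
Qed.

Let lderive_comb i j (c d e : R) X x :
  (i == 1%N) || (i == 3%N) -> (j == 1%N) || (j == 3%N) ->
  lderive M X (fun x => c * cof P i x + d * cof P j x + e : R^o) x
  = c * cof P i X + d * cof P j X.
Proof.
have [[b1 _ b3 _] _ _] := dP x X; move=> i13 j13; rewrite /lderive derive_comb !cofD !cofZ.
by case/orP: i13 => /eqP ->; case/orP: j13 => /eqP ->; rewrite ?b1 ?b3; ring.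
Qed.

(** The cocycle condition fails by the value of the phase on pairs of lattice
    elements, which is where the hypothesis [quantized] enters. *)
Lemma constant_connection : exists A : u1_connection M, pot A = potential.
Proof.
have lin x a X Y : potential x (fun=> a *: X + Y) =
    a * potential x (fun=> X) + potential x (fun=> Y).
  by rewrite /potential /translation_phase !cofDZ; ring.
have psm v : smooth (fun x => potential x v).
  by apply: affine_smooth; rewrite potE; apply: affine_comb; apply: cof_affine.
have fsm g : lattice M g -> smooth (translation_phase g).
  move=> _; apply: affine_smooth; rewrite phaseE.
  by apply: affine_comb; apply: cof_affine.
have coc g h : lattice M g -> lattice M h -> forall x, exists n : int,
    translation_phase (gmul M g h) x =
    translation_phase g (gmul M h x) + translation_phase h x + 2 * pi * n%:~R.
  move=> Mg Mh x; have [n nE] := quantized Mg Mh; exists (- n).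
  by rewrite mulrNz mulrN -nE /translation_phase !cof_gmul //; ring.
have inv g : lattice M g -> forall x v, potential (gmul M g x) v =
    potential x v + lderive M (v ord0) (translation_phase g : _ -> R^o) x.
  move=> _ x v; rewrite phaseE lderive_comb // /potential /translation_phase !cof_gmul //.
  by ring.
by exists (U1Connection lin psm fsm coc inv).
Qed.

Lemma constant_curv (A : u1_connection M) : pot A = potential ->
  forall x v, u1_curv A x v = asd P 0 1 0 (v o0) (v o1).
Proof.
move=> AE x v; rewrite /u1_curv /ext_d AE.
under [X in _ + X]eq_bigr do rewrite big_mkcond.
rewrite !(big_ord_recl, big_ord0) /= /bump /= !potE !lderive_comb //.
have [[b1 _ b3 _] b5 _] := dP (v o0) (v o1).
rewrite /potential /translation_phase !lift_lift0 /= ?eqxx b1 b3 b5 /k /asd /ee.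
have b10 : 1 - b != 0 by rewrite subr_eq0 eq_sym.
by field; rewrite t_neq0 b10.
Qed.

Lemma constant_instanton : exists A : u1_connection M, abelian_instanton P A.
Proof.
have [A AE] := constant_connection; exists A, (fun _ _ => 0), (fun _ _ => 0).
have sqrt4 : Num.sqrt (4^-1 - 0 ^+ 2) = 2^-1 :> R.
  by rewrite expr0n subr0 (_ : 4^-1 = 2^-1 ^+ 2) ?sqrtr_sqr ?ger0_norm //; field.
have d0 (c : R[i]) : rderive0 (fun=> c) = 0 by rewrite /rderive0 !derive1_cst.
split=> [z w|x v|z w|z w].
- by rewrite normr0.
- rewrite (constant_curv AE) /= sqrt4.
  rewrite (_ : asd P 0 1 0 = asd P (2 * 0) (2 * 2^-1) (2 * 0)); last first.
    by rewrite mulr0 divff // pnatr_eq0.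
  rewrite -(instanton_form P _ _ _ x) /expi oppr0 cos0 sin0.
  by congr (_ + _ * _ - _ * _); apply/eqP; rewrite eq_complex /=;
    apply/andP; split; apply/eqP; ring.
- by rewrite /dz1 /dz2 !d0 !(mulr0, subr0, addr0).
- by rewrite /dz1 /dz2 !d0 !(mulr0, subr0, addr0).
Qed.

End ConstantInstanton.

(** * Lattices in R^4 *)

Section Dirichlet.
Context (R : realType).

Lemma entry_le_norm n (x : 'rV[R]_n) i : `|x ord0 i| <= `|x|.
Proof.
rewrite [leRHS]/Num.norm /= mx_normrE.
by rewrite (le_bigmax _ (fun ij => `|x ij.1 ij.2|) (ord0, i)).
Qed.

Lemma mulmx_small n m (d : 'rV[R]_n) (G : 'M[R]_(n, m)) (e : R) i :
  (forall j, `|d ord0 j| <= e) ->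
  `|(d *m G) ord0 i| <= e * \sum_j \sum_i `|G j i|.
Proof.
move=> d_le; rewrite mxE (le_trans (ler_norm_sum _ _ _)) // mulr_sumr.
apply: ler_sum => j _; rewrite normrM ler_pM // (bigD1 i) //= lerDl.
by rewrite sumr_ge0.
Qed.

Context (Lam : set 'rV[R]_4).
Hypotheses (Lam0 : Lam 0) (LamD : forall r r', Lam r -> Lam r' -> Lam (r + r'))
  (LamN : forall r, Lam r -> Lam (- r)).

Let LamMn r n : Lam r -> Lam (r *+ n).
Proof. by move=> Lr; elim: n => [|n IH]; rewrite ?mulr0n // mulrS; apply: LamD. Qed.

Let LamMz r (z : int) : Lam r -> Lam (r *~ z).
Proof. by move=> Lr; case: z => n; [|apply: LamN]; apply: LamMn. Qed.

Let Lam_sum n (F : 'I_n -> 'rV[R]_4) : (forall i, Lam (F i)) -> Lam (\sum_i F i).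
Proof. by move=> LF; elim/big_ind: _. Qed.

(** Dirichlet's pigeonhole argument: among the multiples q r with 0 <= q <= K^4 two
    have fractional parts, with respect to the basis, in the same one of K^4 small
    cells; their difference is close to an integral combination of the basis, hence
    equal to it by discreteness. *)
Lemma discrete_integral (G : 'M[R]_4) (e : R) : G \in unitmx -> (forall i, Lam (row i G)) ->
  0 < e -> (forall r, Lam r -> (forall i, `|r ord0 i| < e) -> r = 0) ->
  exists2 N : nat, (0 < N)%N & forall r, Lam r -> forall j, exists z : int,
    N%:R * (r *m invmx G) ord0 j = z%:~R.
Proof.
move=> G_unit LG e0 discr; pose S := \sum_j \sum_i `|G j i|.
have S0 : 0 <= S by apply: sumr_ge0 => j _; apply: sumr_ge0.
pose K := (Num.truncn (S / e)).+1.
have K0 : 0 < K%:R :> R by rewrite ltr0n.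
have SK : S / K%:R < e.
  by rewrite ltr_pdivrMr // mulrC -ltr_pdivrMr // /K truncnS_gt.
exists (K ^ 4)`!%N => [|r Lr]; first exact: fact_gt0.
set y := r *m invmx G.
pose fr q j : R := q%:R * y ord0 j - (Num.floor (q%:R * y ord0 j))%:~R.
have fr_itv q j : 0 <= fr q j < 1.
  have := Num.Theory.floor_itv (q%:R * y ord0 j).
  by rewrite /fr subr_ge0 ltrBlDl intrD1 => /andP[-> ->].
have cell_lt q j : (Num.truncn (K%:R * fr q j) < K)%N.
  have /andP[fr0 fr1] := fr_itv q j.
  rewrite truncn_lt_nat; last exact: mulr_ge0 (ltW K0) fr0.
  by rewrite -[ltRHS]mulr1 ltr_pM2l.
pose cell (q : 'I_(K ^ 4).+1) : {ffun 'I_4 -> 'I_K} := [ffun j => Ordinal (cell_lt q j)].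
have [a [c [ac cac]]] : exists a c : 'I_(K ^ 4).+1, (a < c)%N /\ cell a = cell c.
  have /injectivePn[a [c aNc cac]] : ~~ injectiveb cell.
    apply/negP => /injectiveP/leq_card.
    by rewrite card_ffun !card_ord ltnn.
  by have [ac|ca|/val_inj/eqP] := ltngtP a c; [exists a, c|exists c, a|rewrite (negPf aNc)].
pose m := (c - a)%N.
pose n j := Num.floor (c%:R * y ord0 j) - Num.floor (a%:R * y ord0 j).
pose d := \row_j (fr c j - fr a j).
have dE j : d ord0 j = m%:R * y ord0 j - (n j)%:~R.
  by rewrite mxE /fr /n /m natrB 1?ltnW // intrB; ring.
have d_le j : `|d ord0 j| <= K%:R^-1.
  have /(congr1 (fun f : {ffun 'I_4 -> 'I_K} => nat_of_ord (f j))) := cac.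
  rewrite !ffunE /= => eqt; rewrite mxE.
  have /andP[a0 _] := fr_itv a j; have /andP[c0 _] := fr_itv c j.
  have /andP[] := truncn_itv (mulr_ge0 (ltW K0) a0).
  have /andP[] := truncn_itv (mulr_ge0 (ltW K0) c0).
  rewrite -eqt => c1 c2 a1 a2.
  rewrite -[leRHS]mul1r ler_pdivlMr // -[X in _ * X](ger0_norm (ltW K0)) -normrM.
  by rewrite ler_norml; apply/andP; move: c1 c2 a1 a2; rewrite -!natr1; split; lra.
have LdG : Lam (d *m G).
  have -> : d *m G = r *+ m - \sum_j (row j G) *~ n j.
    rewrite mulmx_sum_row; under eq_bigr do rewrite dE scalerBl scaler_int.
    rewrite sumrB; congr (_ - _).
    rewrite -[in RHS](mulmxKV G_unit r) -/y (mulmx_sum_row y) -sumrMnl.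
    by apply: eq_bigr => j _; rewrite mulr_natl scalerMnl.
  by apply: LamD; [apply: LamMn|apply/LamN/Lam_sum => j; apply: LamMz].
have /discr dG0 := LdG.
have /(congr1 (mulmx^~ (invmx G))) : d *m G = 0.
  apply: dG0 => i; apply: le_lt_trans SK.
  by rewrite mulrC; apply: mulmx_small.
rewrite mulmxK // mul0mx => d0 j.
have my : m%:R * y ord0 j = (n j)%:~R.
  by apply/eqP; rewrite -subr_eq0 -dE d0 mxE.
have mdvd : (m %| (K ^ 4)`!)%N.
  by apply: dvdn_fact; rewrite subn_gt0 ac /= leq_subLR (leq_trans (leq_ord c)) // leq_addl.
exists (Posz ((K ^ 4)`! %/ m)%N * n j).
by rewrite -{1}(divnK mdvd) natrM -mulrA my intrM.
Qed.

End Dirichlet.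

(** * The projection of the lattice to the abelianization *)

Section ProjectedLattice.
Context (R : realType) (M : nilmanifold R) (s : R) (U : 'M[R]_6).
Hypothesis nfU : normal_form M s U.

Let U_unit : U \in unitmx. Proof. by case: nfU. Qed.
Let dU := proj2 nfU.

Definition proj4 (x : vec R) : 'rV[R]_4 := \row_(j < 4) cof U j.+1 x.

Definition projected_lattice : set 'rV[R]_4 := [set r | exists2 g, lattice M g & proj4 g = r].

Let proj4_gmul g h : proj4 (gmul M g h) = proj4 g + proj4 h.
Proof.
have [[b1 b2 b3 b4] _ _] := dU g h.
apply/rowP => -[[|[|[|[|j]]]] j4] //; rewrite !mxE /gmul !cofD cofZ /=;
  by rewrite (b1, b2, b3, b4) mulr0 addr0.
Qed.

Let proj4N g : proj4 (- g) = - proj4 g.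
Proof. by apply/rowP => j; rewrite !mxE cofN. Qed.

Lemma projected_lattice0 : projected_lattice 0.
Proof. by exists 0; [exact: lattice1|apply/rowP => j; rewrite !mxE cof0]. Qed.

Lemma projected_latticeD r r' :
  projected_lattice r -> projected_lattice r' -> projected_lattice (r + r').
Proof.
move=> [g Mg <-] [h Mh <-]; exists (gmul M g h); last exact: proj4_gmul.
exact: latticeM.
Qed.

Lemma projected_latticeN r : projected_lattice r -> projected_lattice (- r).
Proof. by move=> [g Mg <-]; exists (- g); [exact: latticeV|exact: proj4N]. Qed.

Lemma functional_bounded (w : 'cV[R]_4) : exists2 B : R, 0 <= B &
  forall x : vec R, `|(proj4 x *m w) ord0 ord0| <= B * `|x|.
Proof.
pose v := \matrix_(i < 6, j < 4) U i (ix j.+1) *m w.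
exists (\sum_j \sum_i `|v j i|).
  by apply: sumr_ge0 => j _; apply: sumr_ge0.
move=> x; rewrite mulrC.
have -> : proj4 x *m w = x *m v.
  rewrite /v mulmxA; congr (_ *m _); apply/rowP => j; rewrite mxE /cof !mxE.
  by apply: eq_bigr => i _; rewrite mxE.
by apply: mulmx_small => j; apply: entry_le_norm.
Qed.

(** A functional vanishing on the lattice would be bounded on the whole group, by
    cocompactness. *)
Lemma projected_lattice_full (w : 'cV[R]_4) : w != 0 ->
  exists2 r, projected_lattice r & (r *m w) ord0 ord0 != 0.
Proof.
move=> w0; apply: contrapT => killed.
have Lw g : lattice M g -> (proj4 g *m w) ord0 ord0 = 0.
  move=> Mg; apply/eqP; apply: contrapT => /negP ng; apply: killed.
  by exists (proj4 g) => //; exists g.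
have [K /compact_bounded [B [_ KB]] cover] := lattice_cocompact M.
have {}KB x : K x -> `|x| <= B + 1 by apply: KB; rewrite ltrDl.
have [S S0 wS] := functional_bounded w.
have [i wi] : exists i, w i ord0 != 0.
  by have /matrix0Pn[i [j]] := w0; rewrite (ord1 j); exists i.
pose x := (((B + 1) * S + 1) / w i ord0) *: frame U (ix i.+1).
have wx : (proj4 x *m w) ord0 ord0 = (B + 1) * S + 1.
  rewrite mxE (bigD1 i) //= big1 ?addr0 => [|j jNi]; rewrite mxE cofZ cof_frame // ix_eq.
  - by rewrite eqxx mulr1 divfK.
  - by case: i {wi x} => [[|[|[|[|i]]]] i4].
  - by case: i {wi x} => [[|[|[|[|i]]]] i4].
  - by rewrite eqSS (inj_eq val_inj) eq_sym (negPf jNi) mulr0 mul0r.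
  - by case: i {wi x jNi} => [[|[|[|[|i]]]] i4].
  - by case: j {jNi} => [[|[|[|[|j]]]] j4].
have [g [k [Mg Kk xE]]] := cover x.
move: wx; rewrite xE proj4_gmul mulmxDl mxE Lw // add0r => wk.
have := le_trans (wS k) (ler_wpM2l S0 (KB k Kk)).
by rewrite wk => /(le_trans (ler_norm _)); rewrite mulrC; lra.
Qed.

(** A maximal independent family in the lattice has four elements: otherwise some
    functional kills it, and an element on which this functional does not vanish can
    be added. *)
Lemma projected_lattice_basis : exists2 G : 'M[R]_4, G \in unitmx &
  forall i, projected_lattice (row i G).
Proof.
suff H r : (r <= 4)%N -> exists2 G : 'M[R]_(r, 4), row_free G &
    forall i, projected_lattice (row i G).
  by have [G fG LG] := H 4 (leqnn 4); exists G; rewrite -?row_free_unit.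
elim: r => [_|r IH r4].
  by exists 0 => [|[]//]; rewrite /row_free mxrank0.
have [G fG LG] := IH (ltnW r4).
have : cokermx G != 0.
  by rewrite -mxrank_eq0 mxrank_coker (eqP fG) subn_eq0 -ltnNge.
case/matrix0Pn => i [j Gij]; pose w := col j (cokermx G).
have w0 : w != 0 by apply/matrix0Pn; exists i, ord0; rewrite mxE.
have Gw : G *m w = 0 by rewrite /w colE mulmxA mulmx_coker mul0mx.
have [v Lv vw] := projected_lattice_full w0.
exists (col_mx v G : 'M[R]_(1 + r, 4)) => [|k].
  have vG : ~~ (v <= G)%MS.
    apply/negP => /submxP[d vE]; move/eqP: vw; apply.
    by rewrite vE -mulmxA Gw mulmx0 mxE.
  have : (G < col_mx v G)%MS.
    by rewrite ltmxE -!addsmxE addsmxSr addsmx_sub negb_and vG.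
  by move/rank_ltmx; rewrite (eqP fG) /row_free eqn_leq rank_leq_row.
case: (@split_ordP 1 r k) => i' ->; last by have := LG i'; rewrite -(rowKd i' v G).
suff rE : row (lshift r i') (col_mx v G) = v by exact: (eq_ind_r projected_lattice Lv rE).
by rewrite rowKu; apply/rowP => l; rewrite mxE ord1.
Qed.

Let bra0l Y : bra M 0 Y = 0.
Proof.
by have := bra_linear_l M (-1) 0 0 Y; rewrite scaler0 addr0 scaleN1r addNr.
Qed.

Let braC X Y : bra M X Y = - bra M Y X.
Proof.
have := bra_alt M (1 *: X + Y).
rewrite bra_linear_l !bra_linear_r !bra_alt !scale1r add0r addr0.
by move/eqP; rewrite addr_eq0 => /eqP.
Qed.

(** In exponential coordinates of a group of step two the commutator of two
    elements is their bracket. *)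
Lemma lattice_bra g h : lattice M g -> lattice M h -> lattice M (bra M g h).
Proof.
move=> Mg Mh; set B := bra M g h.
have -> : B = gmul M (gmul M g h) (- gmul M h g).
  have gE : gmul M g h = 2^-1 *: B + (g + h) by rewrite /gmul addrC.
  have hE : - gmul M h g = 2^-1 *: B + (-1) *: (g + h).
    by rewrite /gmul (braC h g) -/B scaleN1r scalerN opprD opprK addrC [h + g]addrC.
  have B0 X : bra M B X = 0 by rewrite braC /B nil_step2 oppr0.
  rewrite {1}/gmul {2}gE {2}hE bra_linear_l B0 scaler0 add0r.
  rewrite -[(-1) *: (g + h)]addr0 !bra_linear_r bra_alt nil_step2 !scaler0 !add0r.
  have -> : bra M (g + h) 0 = 0 by rewrite braC bra0l oppr0.
  rewrite scaler0 addr0 gE hE scaleN1r addrACA subrr addr0 -scalerDl.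
  by rewrite (_ : 2^-1 + 2^-1 = 1) ?scale1r //; field.
by apply: latticeM; [|apply: latticeV]; apply: latticeM.
Qed.

Let cof_bra_nf X Y :
  (cof U 1 (bra M X Y) = 0) * (cof U 2 (bra M X Y) = 0) * (cof U 3 (bra M X Y) = 0) *
  (cof U 4 (bra M X Y) = 0) *
  (cof U 5 (bra M X Y) = - (s * ee U 1 3 X Y + ee U 2 4 X Y)) *
  (cof U 6 (bra M X Y) = - (ee U 1 4 X Y + ee U 2 3 X Y)) :> Type.
Proof. by have [[-> -> -> ->] -> ->] := dU X Y. Qed.

Let bra_expand X Y : bra M X Y = \sum_(j < 4) proj4 X ord0 j *: bra M (frame U (ix j.+1)) Y.
Proof.
rewrite !(big_ord_recl, big_ord0) !mxE /= /bump /= !add1n addr0.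
apply: (cof_inj U_unit) => -[[|[|[|[|[|[|k]]]]]] k6] //;
  by rewrite !(cofD, cofZ) /= !cof_bra_nf /ee ?(cof_frame_ix U_unit) //=; ring.
Qed.

(* The form u^14 + u^23 of the pencil is already nondegenerate. *)
Let bra_radical X (G : 'M[R]_4) (h : 'I_4 -> vec R) : G \in unitmx ->
  (forall i, proj4 (h i) = row i G) -> (forall i, bra M X (h i) = 0) -> proj4 X = 0.
Proof.
move=> G_unit hG X0.
pose c : 'cV[R]_4 := \col_i nth 0 [:: - cof U 4 X; - cof U 3 X; cof U 2 X; cof U 1 X] i.
have : G *m c = 0.
  apply/colP => i; have [_ _] := dU X (h i); rewrite X0 cof0 => /eqP.
  rewrite eq_sym oppr_eq0 => /eqP bra6; rewrite [RHS]mxE -[RHS]bra6.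
  have hE j : G i j = cof U j.+1 (h i).
    by have /rowP/(_ j) := hG i; rewrite !mxE.
  by rewrite mxE !(big_ord_recl, big_ord0) /c !mxE !hE /= /bump /= !add1n /ee; ring.
move/(congr1 (mulmx (invmx G))); rewrite mulKmx // mulmx0 => /colP c0.
apply/rowP => -[[|[|[|[|j]]]] j4] //; rewrite !mxE /=.
- by have := c0 o3; rewrite !mxE.
- by have := c0 o2; rewrite !mxE.
- by have /eqP := c0 o1; rewrite !mxE /= oppr_eq0 => /eqP.
- by have /eqP := c0 o0; rewrite !mxE /= oppr_eq0 => /eqP.
Qed.

(** The bracket with an element h of the lattice is a commutator, so it maps the
    lattice to itself, and it only depends on the projection.  If the projection of g
    is small, then [g, h] = 0 by discreteness for each h in a basis, so that g is
    central, that is, has projection zero. *)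
Lemma projected_lattice_discrete : exists2 e : R, 0 < e &
  forall r, projected_lattice r -> (forall i, `|r ord0 i| < e) -> r = 0.
Proof.
have [G G_unit LG] := projected_lattice_basis.
have /boolp.choice[h hP] i : exists v, lattice M v /\ proj4 v = row i G.
  by have [g Mg gE] := LG i; exists g.
have [r r0 discr] := lattice_discrete M.
pose S := \sum_(i < 4) \sum_(j < 4) `|bra M (frame U (ix j.+1)) (h i)|.
have S0 : 0 <= S by apply: sumr_ge0 => i _; apply: sumr_ge0.
have S1 : 0 < S + 1 by lra.
exists (r / (S + 1)) => [|_ [g Mg <-] g_small]; first exact: divr_gt0.
apply: (bra_radical G_unit (fun i => proj2 (hP i))) => i.
apply: discr; first exact: lattice_bra (proj1 (hP i)).
rewrite bra_expand (le_lt_trans (ler_norm_sum _ _ _)) //.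
apply: (@le_lt_trans _ _ (r / (S + 1) * S)); last first.
  by rewrite -mulrA -[ltRHS]mulr1 ltr_pM2l // mulrC ltr_pdivrMr // mul1r; lra.
rewrite [X in _ * X](bigD1 i) //= mulrDr ler_wpDr //.
  apply: mulr_ge0; first by rewrite divr_ge0 ?ltW.
  by apply: sumr_ge0 => k _; apply: sumr_ge0.
rewrite mulr_sumr; apply: ler_sum => j _; rewrite normrZ ler_wpM2r //.
by rewrite ltW // g_small.
Qed.

Lemma projected_lattice_integral : exists2 V : 'M[R]_4, V \in unitmx &
  exists2 N : nat, (0 < N)%N & forall g, lattice M g -> forall j, exists z : int,
    N%:R * (proj4 g *m V) ord0 j = z%:~R.
Proof.
have [G G_unit LG] := projected_lattice_basis.
have [e e0 discr] := projected_lattice_discrete.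
have [N N0 int_N] := discrete_integral projected_lattice0 projected_latticeD
  projected_latticeN G_unit LG e0 discr.
exists (invmx G); first by rewrite unitmx_inv.
by exists N => // g Mg; apply: int_N; exists g.
Qed.

End ProjectedLattice.

(** * Existence of solutions *)

Section NaturalPoints.
Context (R : realType).

Lemma poly_nat_roots (p : {poly R}) : (forall n : nat, p.[n%:R] = 0) -> p = 0.
Proof.
move=> p0; apply/eqP; apply: contraT => pN0.
have := max_poly_roots (rs := [seq i%:R | i <- iota 0 (size p)]) pN0.
rewrite size_map size_iota ltnn => -> //.
  by apply/allP => _ /mapP[i _ ->]; rewrite rootE p0.
by rewrite map_inj_uniq ?iota_uniq //; exact: mulrIn (oner_neq0 R).
Qed.

(** A function that is polynomial on each line and vanishes at all points with natural
    coordinates vanishes identically: free the coordinates one at a time. *)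
Lemma nat_point n (f : 'cV[R]_n -> R) :
  (forall x w, exists p : {poly R}, forall c, f (x + c *: w) = p.[c]) ->
  (exists x, f x != 0) -> exists m : 'I_n -> nat, f (\col_i (m i)%:R) != 0.
Proof.
move=> f_poly [x0 fx0]; apply: contrapT => vanish; case/negP: fx0; apply/eqP.
have {}vanish m : f (\col_i (m i)%:R) = 0.
  by apply/eqP; apply: contrapT => /negP fm; apply: vanish; exists m.
suff H k (x : 'cV[R]_n) :
    (forall i : 'I_n, (k <= i)%N -> exists m : nat, x i ord0 = m%:R) -> f x = 0.
  by apply: (H n) => i; rewrite leqNgt ltn_ord.
elim: k x => [x xP|k IH x xP].
  have /boolp.choice[m mP] i := xP i (leq0n i).
  by rewrite (_ : x = \col_i (m i)%:R) //; apply/colP => i; rewrite mxE mP.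
have [kn|nk] := ltnP k n; last first.
  by apply: IH => i ki; have := leq_trans nk ki; rewrite leqNgt ltn_ord.
pose i0 := Ordinal kn; pose d : 'cV[R]_n := delta_mx i0 ord0.
have [p pE] := f_poly (x - x i0 ord0 *: d) d.
have p0 : p = 0.
  apply: poly_nat_roots => m; rewrite -pE; apply: IH => i ki.
  rewrite !mxE /=; have [->|iNi0] := eqVneq i i0.
    by exists m; rewrite !mulr1 subrr add0r.
  have [|j ->] := xP i; last by exists j; rewrite !mulr0 subr0 addr0.
  by rewrite ltn_neqAle ki andbT eq_sym -(inj_eq val_inj) in iNi0 *.
by have := pE (x i0 ord0); rewrite subrK p0 horner0.
Qed.

End NaturalPoints.

Section Existence.
Context (R : realType).

Lemma nondegenerate_nat_pair (s : R) (V : 'M[R]_4) : V \in unitmx ->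
  exists m n : 'I_4 -> nat,
    let x i := (V *m \col_i (m i)%:R) i ord0 in
    let y i := (V *m \col_i (n i)%:R) i ord0 in
    pencilA s x y ^+ 2 - s * pencilB x y ^+ 2 != 0.
Proof.
move=> V_unit; pose co (x : 'cV[R]_4) i := (V *m x) i ord0.
pose N x y := pencilA s (co x) (co y) ^+ 2 - s * pencilB (co x) (co y) ^+ 2.
have coD x c w i : co (x + c *: w) i = co x i + c * co w i.
  by rewrite /co mulmxDr -scalemxAr !mxE.
have ax x c w y : pencilA s (co (x + c *: w)) (co y) =
    pencilA s (co x) (co y) + c * pencilA s (co w) (co y).
  by rewrite /pencilA !coD; ring.
have bx x c w y : pencilB (co (x + c *: w)) (co y) =
    pencilB (co x) (co y) + c * pencilB (co w) (co y).
  by rewrite /pencilB !coD; ring.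
have ay x c w y : pencilA s (co y) (co (x + c *: w)) =
    pencilA s (co y) (co x) + c * pencilA s (co y) (co w).
  by rewrite /pencilA !coD; ring.
have by' x c w y : pencilB (co y) (co (x + c *: w)) =
    pencilB (co y) (co x) + c * pencilB (co y) (co w).
  by rewrite /pencilB !coD; ring.
(* the norm along a line on which both pencil forms are affine *)
pose pol (a a' b b' : R) := (a%:P + 'X * a'%:P) ^+ 2 - s%:P * (b%:P + 'X * b'%:P) ^+ 2.
(* u^1 and u^3 themselves have norm 1. *)
have N0 : N (invmx V *m delta_mx o0 ord0) (invmx V *m delta_mx o2 ord0) != 0.
  rewrite /N /co !mulKVmx // /pencilA /pencilB !mxE /=.
  by rewrite (_ : _ - _ = 1) ?oner_eq0 //; ring.
have [x w||m mP] := @nat_point R 4 (fun x => N x (invmx V *m delta_mx o2 ord0)).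
- by eexists (pol _ _ _ _) => c; rewrite /N ax bx /pol !hornerE.
- by eexists; exact: N0.
have [y w||n nP] := @nat_point R 4 (N (\col_i (m i)%:R)).
- by eexists (pol _ _ _ _) => c; rewrite /N ay by' /pol !hornerE.
- by eexists; exact: mP.
by exists m, n.
Qed.

(** If N xi and N eta are integral on the lattice, then for l^2 = 2 pi N^2 (1 - b) the
    phase (1 - b)^-1 l^2 (xi /\ eta) takes values in 2 pi Z on the lattice. *)
Lemma solution_exists (M : nilmanifold R) (s k b : R) (U : 'M[R]_6) :
  normal_form M s U -> b < 1 -> k != 0 -> s * (1 - b) = k ^+ 2 * (b ^+ 2 + 3) * (1 + b) ->
  exists (t : R) (P : 'M[R]_6) (A : u1_connection M),
    [/\ t != 0, adapted_coframe M b t P, abelian_instanton P A & heterotic_solution P A].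
Proof.
move=> nfU b1 k0 skb; have [V V_unit [N N0 int_N]] := projected_lattice_integral nfU.
have [m [n /= nondeg]] := nondegenerate_nat_pair s V_unit.
set x := (fun i => _) in nondeg; set y := (fun i => (V *m \col_i (n i)%:R) i ord0) in nondeg.
have [U' nfU' U'E] := adjusted_normal_form nfU nondeg.
have [t [t0 Dp D]] := admissible_t b.
have lin4_int (m' : 'I_4 -> nat) g : lattice M g -> exists z : int,
    N%:R * lin4 U (fun i => (V *m \col_i (m' i)%:R) i ord0) g = z%:~R.
  move=> Mg; have /boolp.choice[z zP] j := int_N g Mg j.
  exists (\sum_j z j * (m' j)%:Z).
  have -> : lin4 U (fun i => (V *m \col_i (m' i)%:R) i ord0) g =
      (proj4 U g *m V *m \col_i (m' i)%:R) ord0 ord0.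
    by rewrite -mulmxA [RHS]mxE; apply: eq_bigr => i _; rewrite [in RHS]mxE.
  rewrite mxE mulr_sumr rmorph_sum; apply: eq_bigr => j _.
  by rewrite mulrA zP mxE /= intrM.
pose l := Num.sqrt (2 * pi * N%:R ^+ 2 * (1 - b)).
have b10 : 0 < 1 - b by rewrite subr_gt0.
have l2_gt0 : 0 < 2 * pi * N%:R ^+ 2 * (1 - b).
  by rewrite !mulr_gt0 // ?pi_gt0 ?ltr0n.
have l0 : l != 0 by rewrite gt_eqF // sqrtr_gt0.
have l2 : l ^+ 2 = 2 * pi * N%:R ^+ 2 * (1 - b) by rewrite sqr_sqrtr // ltW.
have bN1 : b != 1 by rewrite lt_eqF.
have [P [P_unit dP PE]] := normal_form_adapted nfU' k0 l0 bN1 t0 skb.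
have P_adapted : adapted_coframe M b t P by apply/(adapted_coframeP _ _ _ t0).
have [|A A_inst] := constant_instanton t0 bN1 dP.
  move=> g h Mg Mh.
  have [xg xgE] := lin4_int m g Mg; have [xh xhE] := lin4_int m h Mh.
  have [yg ygE] := lin4_int n g Mg; have [yh yhE] := lin4_int n h Mh.
  exists (xg * yh - yg * xh); rewrite intrB !intrM -xgE -yhE -ygE -xhE -/x -/y.
  rewrite /translation_phase; have [-> ->] := PE g; have [-> ->] := PE h.
  have [-> ->] := U'E g; have [-> ->] := U'E h.
  set xg' := lin4 U x g; set xh' := lin4 U x h.
  set yg' := lin4 U y g; set yh' := lin4 U y h.
  transitivity ((1 - b)^-1 * l ^+ 2 * (xg' * yh' - yg' * xh')); first by ring.
  by rewrite l2; move: (pi : R) => q; field; rewrite lt0r_neq0.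
by exists t, P, A; split=> //; apply: (adapted_heterotic_solution (b := b) (t := t)).
Qed.

End Existence.

Theorem theorem6p1 (R : realType) :
  (forall (b t : R) (M : nilmanifold R) (P : 'M[R]_6) (A : u1_connection M),
     t != 0 -> has_algebra b M -> adapted_coframe M b t P ->
     abelian_instanton P A ->
     (t ^+ 4 * (b ^+ 4 + 4 * b ^+ 2 + 11) - 1 != 0 ->
      anomaly P A (levi_civita M P)
        (16 * pi ^+ 2 * t ^+ 2 * (b ^+ 2 + 3)
         / (t ^+ 4 * (b ^+ 4 + 4 * b ^+ 2 + 11) - 1))) /\
     (4 * t ^+ 4 * (b ^+ 4 + 5 * b ^+ 2 + 10) - 1 != 0 ->
      anomaly P A (bismut M P)
        (16 * pi ^+ 2 * t ^+ 2 * (b ^+ 2 + 3)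
         / (4 * t ^+ 4 * (b ^+ 4 + 5 * b ^+ 2 + 10) - 1))))
  /\
  (forall b : R,
     (exists t : R, [/\ t != 0,
        4^-1 < t ^+ 4 * (b ^+ 4 + 5 * b ^+ 2 + 10) &
        1 < t ^+ 4 * (b ^+ 4 + 4 * b ^+ 2 + 11)]) /\
     (forall t : R, t != 0 ->
        4^-1 < t ^+ 4 * (b ^+ 4 + 5 * b ^+ 2 + 10) ->
        1 < t ^+ 4 * (b ^+ 4 + 4 * b ^+ 2 + 11) ->
        forall (M : nilmanifold R) (P : 'M[R]_6) (A : u1_connection M),
          has_algebra b M -> adapted_coframe M b t P ->
          abelian_instanton P A -> heterotic_solution P A))
  /\
  (forall M : nilmanifold R,
     let solvable_for (range : R -> Prop) :=
       exists (b t : R) (P : 'M[R]_6) (A : u1_connection M),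
         [/\ range b, t != 0, adapted_coframe M b t P,
             abelian_instanton P A & heterotic_solution P A] in
     [/\ is_h2 M -> solvable_for (fun b => `|b| < 1),
         is_h4 M -> solvable_for (fun b => b = 1 \/ b = -1) &
         is_h5 M -> solvable_for (fun b => 1 < b ^+ 2)]).
Proof.
split; [|split].
- move=> b t M P A t0 _ P_adapted A_inst; split.
    exact: anomaly_levi_civita t0 P_adapted A_inst.
  exact: anomaly_bismut t0 P_adapted A_inst.
- move=> b; split=> [|t t0 Dp D M P A _ P_adapted A_inst]; first exact: admissible_t.
  exact: adapted_heterotic_solution t0 P_adapted A_inst Dp D.
- move=> M range_for; split.
  + move=> /h2_normal_form[U nfU].
    (* The relation between s, k and b holds for (1, 1 / sqrt 3, 0), (0, 1, - 1)
       and (- 1, sqrt (3 / 7), - 2). *)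
    have k2 : Num.sqrt (3^-1 : R) ^+ 2 = 3^-1 by rewrite sqr_sqrtr // invr_ge0.
    have [||| t [P [A [t0 Pa Ai sol]]]] :=
      solution_exists (k := Num.sqrt 3^-1) (b := 0) nfU.
    * exact: ltr01.
    * by rewrite gt_eqF // sqrtr_gt0 invr_gt0.
    * by rewrite k2; field.
    by exists 0, t, P, A; rewrite normr0 ltr01.
  + move=> /h4_normal_form[U nfU].
    have [||| t [P [A [t0 Pa Ai sol]]]] := solution_exists (k := 1) (b := -1) nfU.
    * by lra.
    * exact: oner_neq0.
    * by ring.
    by exists (-1), t, P, A; split=> //; right.
  + move=> /h5_normal_form[U nfU].
    have k2 : Num.sqrt (3 / 7 : R) ^+ 2 = 3 / 7 by rewrite sqr_sqrtr // divr_ge0.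
    have [||| t [P [A [t0 Pa Ai sol]]]] :=
      solution_exists (k := Num.sqrt (3 / 7)) (b := -2) nfU.
    * by lra.
    * by rewrite gt_eqF // sqrtr_gt0 divr_gt0.
    * by rewrite k2; field.
    by exists (-2), t, P, A; split=> //; lra.
Qed.
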